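(* Let $n,\delta$ be positive integers with $\delta\le n-1$, let $k$ be an integer with $0\le k<\delta$ and $k\equiv n \pmod 2$, and suppose $n\geq 9\delta-2k+12$. Let $G$ be a graph of order $n$ with minimum degree $\delta$. If $q(G)\geq q\big(K_\delta\vee((\delta-k+1)K_1\cup K_{n-2\delta+k-1})\big)$, then $G$ is $k$-factor-critical unless $G\cong K_\delta\vee ((\delta-k+1)K_1\cup K_{n-2\delta+k-1})$. Moreover, $q\big(K_\delta\vee((\delta-k+1)K_1\cup K_{n-2\delta+k-1})\big)$ is equal to the largest root of $g(x)=0$, where \begin{align*} g(x)&=x^3-(3n-\delta+2k-6)x^2\\ &\quad +(2n^2+(\delta+2k-8)n-4\delta^2+4(k-1)\delta-4k+8)x\\ &\quad -2\delta^3+(4n+4k-10)\delta^2-(2n^2+(4k-10)n+2k^2-10k+12)\delta. \end{align*}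
   Context: All graphs are finite, simple and undirected. $q(G)$ denotes the signless Laplacian spectral radius of $G$, i.e. the largest eigenvalue of $\mathbf{D}(G)+\mathbf{A}(G)$, where $\mathbf{A}(G)$ is the adjacency matrix and $\mathbf{D}(G)$ the diagonal matrix of vertex degrees. $K_m$ is the complete graph on $m$ vertices; $G_1\cup G_2$ is the disjoint union, $mG$ is the disjoint union of $m$ copies of $G$, and $G_1\vee G_2$ is the join (disjoint union plus all edges between $V(G_1)$ and $V(G_2)$). A graph $G$ is $k$-factor-critical if $G-S$ has a perfect matching for every $k$-element subset $S\subseteq V(G)$ (for $k=0$ this means $G$ has a perfect matching). *)

(* Defs.v *)
From HB Require Import structures.
From mathcomp Require Import all_boot all_order all_algebra.
From mathcomp Require Import boolp classical_sets reals.
From mathcomp Require Import spectral complex polyrcf.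

Set Implicit Arguments.
Unset Strict Implicit.
Unset Printing Implicit Defensive.

Import Order.TTheory GRing.Theory Num.Theory.

Local Open Scope ring_scope.

Record sgraph := SGraph {
  vertex :> finType;
  adj : rel vertex;
  adj_sym : symmetric adj;
  adj_irr : irreflexive adj }.

Definition isomorphic (G H : sgraph) : Prop :=
  exists2 f : G -> H, bijective f & forall x y, adj (f x) (f y) = adj x y.

Definition deg (G : sgraph) (x : G) : nat := #|[pred y | adj x y]|.

Definition has_min_degree (G : sgraph) (d : nat) : Prop :=
  (exists x : G, deg x = d) /\ (forall x : G, (d <= deg x)%N).

Section Complete.
Variable m : nat.
Definition complete_adj : rel 'I_m := fun x y => x != y.
Lemma complete_sym : symmetric complete_adj.
Proof. by move=> x y; rewrite /complete_adj eq_sym. Qed.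
Lemma complete_irr : irreflexive complete_adj.
Proof. by move=> x; rewrite /complete_adj eqxx. Qed.
Definition complete : sgraph := SGraph complete_sym complete_irr.
End Complete.

Section UnionJoin.
Variables G H : sgraph.

Definition union_adj : rel (G + H)%type := fun u v =>
  match u, v with
  | inl x, inl y => adj x y
  | inr x, inr y => adj x y
  | _, _ => false
  end.
Lemma union_sym : symmetric union_adj.
Proof. by move=> [x|x] [y|y] //=; rewrite adj_sym. Qed.
Lemma union_irr : irreflexive union_adj.
Proof. by move=> [x|x] /=; rewrite adj_irr. Qed.
Definition union : sgraph := SGraph union_sym union_irr.

Definition join_adj : rel (G + H)%type := fun u v =>
  match u, v with
  | inl x, inl y => adj x y
  | inr x, inr y => adj x y
  | _, _ => true
  end.
Lemma join_sym : symmetric join_adj.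
Proof. by move=> [x|x] [y|y] //=; rewrite adj_sym. Qed.
Lemma join_irr : irreflexive join_adj.
Proof. by move=> [x|x] /=; rewrite adj_irr. Qed.
Definition join : sgraph := SGraph join_sym join_irr.
End UnionJoin.

Section Copies.
Variables (m : nat) (G : sgraph).
Definition copies_adj : rel ('I_m * G)%type :=
  fun u v => (u.1 == v.1) && adj u.2 v.2.
Lemma copies_sym : symmetric copies_adj.
Proof. by move=> u v; rewrite /copies_adj eq_sym adj_sym. Qed.
Lemma copies_irr : irreflexive copies_adj.
Proof. by move=> u; rewrite /copies_adj adj_irr andbF. Qed.
Definition copies : sgraph := SGraph copies_sym copies_irr.
End Copies.

Section Delete.
Variables (G : sgraph) (S : {set G}).
Definition delete_adj : rel {x : G | x \notin S} :=
  fun u v => adj (val u) (val v).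
Lemma delete_sym : symmetric delete_adj.
Proof. by move=> u v; rewrite /delete_adj adj_sym. Qed.
Lemma delete_irr : irreflexive delete_adj.
Proof. by move=> u; rewrite /delete_adj adj_irr. Qed.
Definition delete : sgraph := SGraph delete_sym delete_irr.
End Delete.

Definition is_edge (G : sgraph) (A : {set G}) : Prop :=
  exists x y : G, adj x y /\ A = [set x; y]%SET.

Definition has_perfect_matching (G : sgraph) : Prop :=
  exists M : {set {set G}},
    [/\ forall A, A \in M -> is_edge A, finset.trivIset M & finset.cover M = [set: G]%SET].

Definition factor_critical (k : nat) (G : sgraph) : Prop :=
  forall S : {set G}, #|S| = k -> has_perfect_matching (delete S).

Section Spectrum.
Variable R : realType.

Definition adjacency_mx (G : sgraph) : 'M[R]_#|G| :=
  \matrix_(i, j) (adj (enum_val i) (enum_val j))%:R.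

Definition degree_mx (G : sgraph) : 'M[R]_#|G| :=
  diag_mx (\row_i (deg (enum_val i))%:R).

Definition signless_laplacian (G : sgraph) : 'M[R]_#|G| :=
  degree_mx G + adjacency_mx G.

(* The supremum is a maximum: see q_max below. *)
Definition q (G : sgraph) : R :=
  sup [set x : R | eigenvalue (signless_laplacian G) x]%classic.

End Spectrum.

Definition is_largest_root (R : realType) (f : R -> R) (r : R) : Prop :=
  f r = 0 /\ forall x, f x = 0 -> x <= r.

(* K_d \/ ((d-k+1) K_1 U K_(n-2d+k-1)); the natural-number subtractions are
   exact when k <= d and 2d + 1 <= n. *)
Definition extremal (n d k : nat) : sgraph :=
  join (complete d)
    (union (copies (d - k + 1)%N (complete 1)) (complete (n - 2 * d + k - 1)%N)).

Definition g_poly (R : realType) (n d k x : R) : R :=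
  x ^+ 3 - (3 * n - d + 2 * k - 6) * x ^+ 2
  + (2 * n ^+ 2 + (d + 2 * k - 8) * n - 4 * d ^+ 2 + 4 * (k - 1) * d
     - 4 * k + 8) * x
  - 2 * d ^+ 3 + (4 * n + 4 * k - 10) * d ^+ 2
  - (2 * n ^+ 2 + (4 * k - 10) * n + 2 * k ^+ 2 - 10 * k + 12) * d.

(* Existence of a real eigenvalue of a real symmetric matrix, through its
   complexification. *)
Lemma sym_eigenvalue (R : realType) (n : nat) (A : 'M[R]_n) :
  (0 < n)%N -> A^T = A -> exists a, eigenvalue A a.
Proof.
case: n A => // n A _ symA.
pose B := map_mx (real_complex R) A.
have realB : B \is a mxOver Num.real.
  by apply/mxOverP => i j; rewrite mxE; apply/complex_realP; exists (A i j).
have symB : B \is symmetricmx.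
  apply/is_hermitianmxP; rewrite expr0 scale1r map_mx_id //.
  by apply/matrixP => i j; rewrite !mxE -[in RHS]symA mxE.
have hermB := realsym_hermsym symB realB.
have /orthomx_spectralP defB := hermitian_normalmx hermB.
have /mxOverP/(_ 0 0)/complex_realP[r Er] := hermitian_spectral_diag_real hermB.
exists r; rewrite eigenvalue_root_char -(fmorph_root (real_complex R)).
rewrite map_char_poly -/B -eigenvalue_root_char.
set P := spectralmx B in defB; have uP : P \in unitmx := spectral_unit B.
apply/eigenvalueP; exists (row 0 P).
  by rewrite -row_mul {1}defB !mulmxA mulmxV // mul1mx row_mul
             row_diag_mx -scalemxAl Er -rowE.
apply/eqP => P0; have := congr1 (fun M => M *m invmx P) P0.
rewrite -row_mul mulmxV // mul0mx row1 => /rowP/(_ 0).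
by rewrite !mxE !eqxx => /eqP; rewrite oner_eq0.
Qed.

Lemma q_max (R : realType) (G : sgraph) : (0 < #|G|)%N ->
  eigenvalue (signless_laplacian R G) (q R G) /\
  forall x, eigenvalue (signless_laplacian R G) x -> x <= q R G.
Proof.
move=> G0; set A := signless_laplacian R G.
have symA : A^T = A.
  rewrite /A /signless_laplacian raddfD /= tr_diag_mx; congr (_ + _).
  by apply/matrixP => i j; rewrite !mxE adj_sym.
have [a Aa] := sym_eigenvalue G0 symA.
have p0 : char_poly A != 0 by rewrite monic_neq0 // char_poly_monic.
have rootE x : eigenvalue A x = (x \in rootsR (char_poly A)).
  by rewrite eigenvalue_root_char -roots_on_rootsR // inE.
pose m := \big[Num.max/a]_(x <- rootsR (char_poly A)) x.
have Am : eigenvalue A m.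
  rewrite /m big_seq.
  apply: (big_ind (fun x => eigenvalue A x)) => // [x y Ax Ay|x]; last by rewrite rootE.
  by rewrite /Num.max; case: ifP.
have lem x : eigenvalue A x -> x <= m.
  by rewrite rootE => xs; exact: (@Order.TotalTheory.le_bigmax_seq _ _ _ _ a x xpredT id xs).
have -> : q R G = m.
  apply/le_anti/andP; split; first by apply: ge_sup => [|x]; [exists a|exact: lem].
  by apply: ub_le_sup => //; exists m => x; exact: lem.
by split.
Qed.

(* Main.v *)
(** A graph which is not k-factor-critical has, by the Tutte-Berge formula, a set S with |S| >= k
    whose removal leaves at least |S| - k + 2 components. Let rho be the value of q at the extremal
    graph. Test the signless Laplacian of G against the positive vector equal to 1/|S| on S and to
    1/(rho - |S| - 2 (p - 1)) on a component of size p; it satisfies the eigenvalue equation for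
    rho on each component of the graph obtained from G by completing S and the components. On S
    the supersolution inequality reads
      n + |S| - 2 + |S| (sum of p / (rho - |S| - 2 (p - 1)) over the component sizes p) <= rho.
    Since x / (a - 2x) is convex and every component has size at least max(1, delta - |S| + 1),
    only the sizes with all but one minimal matter, and for these the inequality is strict unless
    |S| = delta, where it is the equation g(rho) = 0. Pairing with the modulus of a top
    eigenvector of G then gives q(G) < rho unless G is the extremal graph. *)

Require Import Defs.
From mathcomp Require Import all_boot all_order all_algebra.
From mathcomp Require Import reals boolp.
From mathcomp Require Import ring lra zify.
Set Implicit Arguments.
Unset Strict Implicit.
Unset Printing Implicit Defensive.
Import Order.TTheory GRing.Theory Num.Theory.

(** * The Tutte-Berge formula *)

(** The points moved by [f] split into pairs [x], [f x]; the induction removes one pair at a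
    time. *)
Lemma odd_card_involution (T : finType) (f : T -> T) (C : {set T}) :
  {in C, forall x, f x \in C} -> {in C, forall x, f (f x) = x} ->
  odd #|C| = odd #|[set x in C | f x == x]|.
Proof.
have [N] := ubnP #|C|; elim: N C => // N IH C ltC fC fK.
have [/existsP[x /andP[xC nfx]]|/existsPn fixC] :=
    boolP [exists x, (x \in C) && (f x != x)]; last first.
  congr (odd _); apply: eq_card => x; rewrite !inE.
  by have := fixC x; case: (x \in C) => //=; rewrite negbK => ->.
have fxC := fC x xC.
have fxD : f x \in C :\ x by rewrite !inE nfx.
have cC : #|C| = #|C :\ x :\ f x|.+2 by rewrite (cardsD1 x) xC (cardsD1 (f x) (_ :\ _)) fxD.
have ltD : #|C :\ x :\ f x| < N by rewrite -ltnS; apply: leq_trans ltC; rewrite cC.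
rewrite cC /= negbK (IH _ ltD).
- congr (odd _); apply: eq_card => y; rewrite !inE.
  have [->|yx] := eqVneq y x; first by rewrite (negPf nfx) !andbF.
  have [->|_] := eqVneq y (f x); last by [].
  by rewrite fK // [x == _]eq_sym (negPf nfx) !andbF.
- move=> y; rewrite !inE => /and3P[yfx yx yC]; rewrite fC // andbT.
  apply/andP; split; last by apply: contraNneq yfx => <-; rewrite fK.
  by apply: contraNneq yx => fyx; rewrite -(fK y yC) fyx fK.
- by move=> y; rewrite !inE => /and3P[_ _ /fK].
Qed.

Section Matchings.
Variables (T : finType) (e : rel T).
Hypotheses (e_sym : symmetric e) (e_irr : irreflexive e).
Implicit Types (A B U : {set T}) (f g : {ffun T -> T}).

(* A matching is encoded as an involution: matched vertices are swapped with
   their partners and the other vertices are fixed. *)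
Definition matching_on A f : bool :=
  [forall x, (f (f x) == x) && ((f x != x) ==> e x (f x) && (x \in A))].

Definition unmatched A f := [set x in A | f x == x].

Definition max_matching A f : bool :=
  matching_on A f &&
  [forall g, matching_on A g ==> (#|unmatched A f| <= #|unmatched A g|)].

Definition conn B := connect [rel x y | [&& x \in B, y \in B & e x y]].

Definition component B x := [set y in B | conn B x y].

Definition components B := equivalence_partition (conn B) B.

Definition odd_components B := [set C in components B | odd #|C|].

Lemma matching_onP A f :
  reflect [/\ involutive f, forall x, f x != x -> e x (f x)
            & forall x, f x != x -> x \in A] (matching_on A f).
Proof.
apply: (iffP forallP) => [H|[H1 H2 H3] x].
  split=> x; have /andP[/eqP fK /implyP fx] := H x; first by [].
    by case/fx/andP.
  by case/fx/andP.
by rewrite H1 eqxx; apply/implyP => fx; rewrite H2 ?H3.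
Qed.

Lemma max_matchingP A f :
  reflect (matching_on A f /\
           forall g, matching_on A g -> #|unmatched A f| <= #|unmatched A g|)
    (max_matching A f).
Proof.
apply: (iffP andP) => -[Af H]; split=> //.
  by move=> g; move/forallP/(_ g)/implyP: H; apply.
by apply/forallP => g; apply/implyP/H.
Qed.

Lemma max_matching_exists A : exists f, max_matching A f.
Proof.
have id0 : matching_on A [ffun x => x].
  by apply/matching_onP; split=> x; rewrite ?ffunE ?eqxx.
case: (arg_minnP (fun f => #|unmatched A f|) id0) => f Af fmin.
by exists f; apply/max_matchingP.
Qed.

Lemma matching_stable A f x : matching_on A f -> x \in A -> f x \in A.
Proof.
case/matching_onP=> fK fe fA xA.
have [->//|nfx] := eqVneq (f x) x.
by apply: fA; rewrite fK eq_sym.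
Qed.

Lemma odd_unmatched A f : matching_on A f -> odd #|unmatched A f| = odd #|A|.
Proof.
move=> Af; rewrite (@odd_card_involution _ f A) //.
  by move=> x; apply: matching_stable.
by move=> x _; case/matching_onP: Af.
Qed.

(* Match x with y, releasing the former partner of y, if any. *)
Definition rematch g x y :=
  [ffun w => if w == x then y else if w == y then x else
             if w == g y then w else g w].

Lemma rematch_matching A g x y : matching_on A g -> x \in unmatched A g ->
  y \in A -> e x y -> matching_on A (rematch g x y).
Proof.
move=> Ag; have [gK ge gA] := matching_onP _ _ Ag.
rewrite inE => /andP[xA /eqP gx] yA exy.
have yx : y != x by apply: contraTneq exy => ->; rewrite e_irr.
have gyx : g y != x by apply: contra yx => /eqP E; rewrite -(gK y) E gx.
have E w : rematch g x y w = if w == x then y else if w == y then x else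
             if w == g y then w else g w by rewrite ffunE.
apply/matching_onP; split=> w; rewrite ?E.
- have [->|wx] := eqVneq w x; first by rewrite (negPf yx) eqxx.
  have [->|wy] := eqVneq w y; first by rewrite eqxx.
  have [wgy|wgy] := eqVneq w (g y).
    by rewrite (negPf wx) (negPf wy) wgy eqxx.
  have -> : g w == x = false.
    by apply: contraNF wx => /eqP gwx; rewrite -(gK w) gwx gx.
  have -> : g w == y = false by apply: contraNF wgy => /eqP <-; rewrite gK.
  have -> : g w == g y = false by apply: contraNF wy => /eqP /(inv_inj gK) ->.
  by rewrite gK.
- have [->//|wx] := eqVneq w x.
  have [->|wy] := eqVneq w y; first by rewrite e_sym.
  by case: ifP => _; [rewrite eqxx|apply: ge].
- have [->//|wx] := eqVneq w x.
  have [->//|wy] := eqVneq w y.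
  by case: ifP => _; [rewrite eqxx|apply: gA].
Qed.

(** In the first case the deficiency drops by two, which contradicts maximality; in the second it is
    preserved, which is the exchange used for Gallai's lemma. *)
Lemma unmatched_rematch A g x y : matching_on A g -> x \in unmatched A g ->
  y \in A -> e x y ->
  unmatched A (rematch g x y) =
    if g y == y then unmatched A g :\ x :\ y else g y |: unmatched A g :\ x.
Proof.
move=> Ag; have [gK ge gA] := matching_onP _ _ Ag.
rewrite inE => /andP[xA /eqP gx] yA exy.
have yx : y != x by apply: contraTneq exy => ->; rewrite e_irr.
have gyx : g y != x by apply: contra yx => /eqP E; rewrite -(gK y) E gx.
have [gy|gy] := eqVneq (g y) y.
  apply/setP => w; rewrite !inE ffunE gy.
  have [->|wx] := eqVneq w x; first by rewrite (negPf yx) !andbF.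
  by have [->|wy] := eqVneq w y; first by rewrite eq_sym (negPf yx) !andbF.
apply/setP => w; rewrite !inE ffunE.
have [->|wx] := eqVneq w x.
  by rewrite (negPf yx) !andbF [x == _]eq_sym (negPf gyx).
have [->|wy] := eqVneq w y.
  by rewrite [x == _]eq_sym (negPf yx) [y == _]eq_sym (negPf gy) !andbF.
have [->|wgy] := eqVneq w (g y); last by [].
by rewrite eqxx (matching_stable Ag).
Qed.

Lemma max_matching_adj A f x y : max_matching A f -> x \in unmatched A f ->
  y \in unmatched A f -> ~~ e x y.
Proof.
case/max_matchingP=> Af fmin xf yf; apply/negP => exy.
have yA : y \in A by case/setIdP: yf.
have := fmin _ (rematch_matching Af xf yA exy).
rewrite unmatched_rematch //; case/setIdP: (yf) => _ ->.
have yx : y != x by apply: contraTneq exy => ->; rewrite e_irr.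
rewrite [leqLHS](cardsD1 x) xf (cardsD1 y (_ :\ _)) !inE yx /=.
by case/setIdP: (yf) => -> ->; rewrite add1n add1n ltnNge leqnSn.
Qed.

(* Gallai's lemma in the form: "no maximum matching misses both" is transitive
   on the vertices which some maximum matching misses. *)
Lemma unmatched_trans A f u v t :
  max_matching A f -> u \in unmatched A f -> v \in unmatched A f -> u != v ->
  (exists2 g, max_matching A g & t \in unmatched A g) ->
  (forall g, max_matching A g -> u \in unmatched A g -> t \in unmatched A g -> False) ->
  (forall g, max_matching A g -> t \in unmatched A g -> v \in unmatched A g -> False) ->
  False.
Proof.
move=> fM uf vf uv [g0 g0M tg0] nut ntv.
pose P g := max_matching A g && (t \in unmatched A g).
have P0 : P g0 by rewrite /P g0M.
(* Among the maximum matchings missing [t], [g] shares as many matched vertices with [f] as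
   possible. *)
case: (arg_maxnP (fun g => #|[set x | (g x == f x) && (f x != x)]|) P0) => g.
case/andP=> gM tg gmax.
have [Ag gmin] := max_matchingP _ _ gM; have [Af fmin] := max_matchingP _ _ fM.
have [gK ge gA] := matching_onP _ _ Ag; have [fK fe fA] := matching_onP _ _ Af.
have cfg : #|unmatched A f| = #|unmatched A g|.
  by apply/eqP; rewrite eqn_leq fmin ?gmin.
(* Otherwise [unmatched A f] would contain [unmatched A g :\ t] and also [u] and [v], which [g]
   covers: one vertex too many. *)
have [x xg nxf] : exists2 x, x \in unmatched A g :\ t & x \notin unmatched A f.
  apply/subsetPn/negP => sub.
  have : #|unmatched A g :\ t :|: [set u; v]| <= #|unmatched A f|.
    by apply/subset_leq_card; rewrite subUset sub; apply/subsetP => w;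
       rewrite !inE => /orP[]/eqP->;
       [case/setIdP: uf => -> ->|case/setIdP: vf => -> ->].
  have ug : u \notin unmatched A g by apply/negP => ug; exact: (nut g).
  have vg : v \notin unmatched A g by apply/negP => vg; exact: (ntv g).
  rewrite cardsU (_ : _ :&: _ = set0) ?cards0 ?subn0; last first.
    apply/setP => w; rewrite in_setI in_set2 in_setD1 in_set0.
    have [->|_] := eqVneq w u; first by rewrite (negPf ug) andbF.
    have [->|_] := eqVneq w v; first by rewrite (negPf vg) andbF.
    by rewrite andbF.
  by rewrite cards2 uv cfg [leqRHS](cardsD1 t) tg addnC leq_add2r.
case/setD1P: xg => xt xg; case/setIdP: (xg) => xA /eqP gx.
have nfx : f x != x by apply: contra nxf => fx; rewrite inE xA.
set y := f x in nfx *.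
have yA : y \in A by apply: matching_stable.
have exy : e x y by apply: fe.
have yg : y \notin unmatched A g.
  by apply/negP => yg; move: (max_matching_adj gM xg yg); rewrite exy.
have gy : g y != y by apply: contra yg => gy; rewrite inE yA.
have gyx : g y != x by apply: contra nfx => /eqP E; rewrite -(gK y) E gx.
have yt : y != t by apply: contraNneq yg => ->.
have A' := rematch_matching Ag xg yA exy.
have U' := unmatched_rematch Ag xg yA exy; rewrite (negPf gy) in U'.
have gyU : g y \notin unmatched A g :\ x.
  by rewrite !inE gK [y == _]eq_sym (negPf gy) !andbF.
have M' : max_matching A (rematch g x y).
  apply/max_matchingP; split=> // g' Ag'; rewrite U' cardsU1 gyU.
  by move: (gmin g' Ag'); rewrite [X in X <= _](cardsD1 x) xg.
have /gmax : P (rematch g x y).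
  rewrite /P M' U' !inE [t == x]eq_sym xt /=; case/setIdP: tg => -> ->.
  by rewrite orbT.
(* Matching [x] with [f x] keeps all agreements with [f] and adds [x] to them, against the choice of
   [g]. *)
rewrite /= leqNgt => /negP; apply; apply: proper_card; apply/properP; split.
  apply/subsetP => w; rewrite !inE ffunE => /andP[/eqP gw fw].
  have [->|wx] := eqVneq w x; first by rewrite eqxx.
  have [wy|wy] := eqVneq w y.
    by move: gyx; rewrite -wy gw wy /y fK eqxx.
  have [wgy|wgy] := eqVneq w (g y); last by rewrite gw eqxx.
  by move: gw; rewrite wgy gK => yE; move: gyx; rewrite -(fK (g y)) -yE /y fK eqxx.
by exists x; rewrite !inE ?ffunE ?eqxx //= gx [x == _]eq_sym (negPf nfx).
Qed.

(** * Components of an induced subgraph, and Berge's inequality *)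

Lemma conn0 B x : conn B x x. Proof. exact: connect0. Qed.

Lemma conn_sym B : symmetric (conn B).
Proof.
by apply: sym_connect_sym => x y /=; rewrite e_sym andbCA.
Qed.

Lemma conn_equivalence B : {in B & &, equivalence_rel (conn B)}.
Proof.
move=> x y z _ _ _; split; first exact: connect0.
by move=> xy; apply: (same_connect (conn_sym B) xy).
Qed.

Lemma partition_components B : partition (components B) B.
Proof. exact: equivalence_partitionP (@conn_equivalence B). Qed.

Lemma component_components B x : x \in B -> component B x \in components B.
Proof. by move=> xB; apply: imset_f. Qed.

Lemma componentsP B C : reflect (exists2 x, x \in B & C = component B x) (C \in components B).
Proof. exact: imsetP. Qed.

Lemma mem_component B x : x \in B -> x \in component B x.
Proof. by move=> xB; rewrite inE xB conn0. Qed.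

Lemma component_eq B C x : C \in components B -> x \in C -> C = component B x.
Proof.
case/componentsP=> z zB -> /setIdP[xB zx]; apply/setP => y; rewrite !inE.
congr (_ && _); exact: (same_connect (conn_sym B) zx).
Qed.

Lemma odd_card_odd_components B : odd #|odd_components B| = odd #|B|.
Proof.
rewrite (card_partition (partition_components B)).
rewrite (bigID (fun C : {set T} => odd #|C|)) /= oddD.
have -> : odd (\sum_(C in components B | ~~ odd #|C|) #|C|) = false.
  by apply: (big_ind (fun s => odd s = false)) => [//|x y ox oy|C /andP[_ /negPf]//];
     rewrite oddD ox oy.
rewrite addbF -sum1_card (eq_bigl (fun C => (C \in components B) && odd #|C|)); last first.
  by move=> C; rewrite inE.
by apply: (big_ind2 (fun s s' => odd s = odd s')) => [//|x y x' y' ox oy|C /andP[_ ->]//];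
   rewrite !oddD ox oy.
Qed.

(** Induction on [A]. A vertex covered by every maximum matching goes into the barrier; if there is
    none, Gallai's lemma leaves at most one unmatched vertex in each component, and the empty
    barrier works. *)
Theorem tutte_berge A : exists2 U : {set T}, U \subset A &
  forall f, max_matching A f -> #|U| + #|unmatched A f| <= #|odd_components (A :\: U)|.
Proof.
have [N] := ubnP #|A|; elim: N A => // N IH A ltA.
have [/existsP[v /andP[vA /forallP vM]]|/existsPn allM] :=
  boolP [exists v, (v \in A) && [forall f, max_matching A f ==> (v \notin unmatched A f)]].
- (* v is covered by every maximum matching: put v into the barrier of A :\ v. *)
  have ltAv : #|A :\ v| < N by move: ltA; rewrite (cardsD1 v) vA.
  have [U' /subsetP sU' HU'] := IH _ ltAv.
  have vU' : v \notin U' by apply/negP => /sU'; rewrite !inE eqxx.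
  exists (v |: U').
    by rewrite subUset sub1set vA; apply/subsetP => x /sU'; case/setD1P.
  move=> f fM; have [g gM] := max_matching_exists (A :\ v).
  have [Ag gmin] := max_matchingP _ _ gM; have [Af fmin] := max_matchingP _ _ fM.
  have [gK ge gA] := matching_onP _ _ Ag.
  have Ag' : matching_on A g.
    by apply/matching_onP; split=> // x /gA /setD1P[].
  have gv : g v = v by apply/eqP; apply: contraT => /gA; rewrite !inE eqxx.
  have vg : v \in unmatched A g by rewrite inE vA gv eqxx.
  have ltfg : #|unmatched A f| < #|unmatched A g|.
    rewrite ltnNge; apply/negP => legf; have /implyP := vM g; rewrite vg /=.
    move/(_ _)/negP; case => //; apply/max_matchingP; split=> // g' /fmin.
    exact: leq_trans.
  have Eg : #|unmatched A g| = #|unmatched (A :\ v) g|.+1.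
    rewrite (cardsD1 v) vg add1n; congr (_.+1); apply: eq_card => x.
    by rewrite !inE andbA.
  (* Both terms of [ltfg] have the parity of [#|A|], so they differ by at least two, which pays for
     adding [v] to the barrier. *)
  have lefg : #|unmatched A f| < #|unmatched (A :\ v) g|.
    have := odd_unmatched Af; rewrite -(odd_unmatched Ag').
    move: ltfg; rewrite Eg ltnS leq_eqVlt => /orP[/eqP->|//].
    by rewrite /=; case: (odd _).
  have := HU' g gM; rewrite setDDl; apply: leq_trans.
  by rewrite cardsU1 vU' add1n addSnnS leq_add2l.
exists set0; rewrite ?sub0set // => f fM; rewrite cards0 add0n setD0.
have missable v : v \in A -> exists2 g, max_matching A g & v \in unmatched A g.
  move=> vA; have := allM v; rewrite vA /= negb_forall => /existsP[g].
  by rewrite negb_imply negbK => /andP[]; exists g.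
(* Induction along the path: no maximum matching misses two adjacent vertices, and [unmatched_trans]
   composes the steps. *)
have conn_missed u v : v \in A -> conn A u v -> u = v \/
    forall g, max_matching A g -> u \in unmatched A g -> v \in unmatched A g -> False.
  move=> vA /connectP[p]; elim: p u => [|t p IHp] u /=; first by move=> _ ->; left.
  case/andP=> /and3P[uA tA eut] tp ev.
  have nut g : max_matching A g -> u \in unmatched A g -> t \in unmatched A g -> False.
    by move=> gM ug tg; move: (max_matching_adj gM ug tg); rewrite eut.
  have [tv|ntv] := IHp t tp ev; first by right=> g; rewrite -tv; apply: nut.
  have [->|uv] := eqVneq u v; [by left|right=> g gM ug vg].
  exact: (unmatched_trans gM ug vg uv (missable t tA)).
have Af : matching_on A f by case/max_matchingP: fM.
rewrite -(@card_in_imset _ _ (component A) (mem (unmatched A f))); last first.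
  move=> u v uf vf E; case/setIdP: (vf) => vA _.
  have : v \in component A u by rewrite E mem_component.
  case/setIdP=> _ /(conn_missed u v vA)[//|].
  by move/(_ f fM uf vf).
apply: subset_leq_card; apply/subsetP => _ /imsetP[u uf ->].
case/setIdP: (uf) => uA fu; rewrite inE component_components //=.
have [fK fe fA] := matching_onP _ _ Af.
(* [f] preserves the component of [u] and fixes only [u] there, so this component is odd. *)
rewrite (@odd_card_involution _ f); last by [].
  have -> : [set x in component A u | f x == x] = [set u].
    apply/setP => x; rewrite !inE; apply/idP/eqP => [/andP[/andP[xA ux] fx]|->].
      have [//|] := conn_missed _ _ xA ux.
      by move/(_ f fM uf); rewrite inE xA fx => /(_ isT).
    by rewrite uA fu conn0.
  by rewrite cards1.
move=> x /setIdP[xA ux]; rewrite inE (matching_stable Af) //=.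
have [->//|nfx] := eqVneq (f x) x.
apply: connect_trans ux (connect1 _) => /=.
by rewrite xA (matching_stable Af) // fe.
Qed.

End Matchings.

(** * Barriers of graphs that are not k-factor-critical *)

Lemma perfect_matching_of_involution (G : sgraph) (S : {set G}) (f : {ffun G -> G}) :
  matching_on (@adj G) (~: S) f -> unmatched (~: S) f = set0 ->
  has_perfect_matching (delete S).
Proof.
move=> fM fU; have [fK fe fA] := matching_onP _ _ _ fM.
have nf x : x \notin S -> f x != x.
  move=> xS; apply/negP => fx; have : x \in unmatched (~: S) f by rewrite !inE xS.
  by rewrite fU inE.
have fS x : x \notin S -> f x \notin S.
  by move=> xS; have := matching_stable fM; move/(_ x); rewrite !inE; apply.
pose F (u : delete S) : delete S := exist _ (f (val u)) (fS _ (valP u)).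
have FK : involutive F by move=> u; apply: val_inj; rewrite /= fK.
have FM (u v : delete S) : v \in [set u; F u] -> [set u; F u] = [set v; F v].
  rewrite !inE => /orP[]/eqP-> //; apply/setP => z; rewrite !inE FK orbC //.
exists [set [set u; F u] | u : delete S]; split.
- move=> _ /imsetP[u _ ->]; exists u, (F u); split=> //.
  by rewrite /adj /= /delete_adj /=; apply/fe/nf/(valP u).
- apply/trivIsetP => _ _ /imsetP[u _ ->] /imsetP[v _ ->].
  apply: contraR => /pred0Pn[z /andP[zu zv]].
  by rewrite (FM u z zu) (FM v z zv).
- apply/setP => u; rewrite inE; apply/bigcupP.
  by exists [set u; F u]; [apply: imset_f|rewrite !inE eqxx].
Qed.

(** Berge's inequality outside a bad [k]-set [S0] gives [U], and the barrier is [S0 :|: U]. As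
    [#|G| - k] is even, the number of odd components has the parity of [#|U|], so it exceeds [#|U|]
    by at least two. *)
Lemma not_factor_critical_barrier (G : sgraph) k :
  k <= #|G| -> ~~ odd (#|G| - k) -> ~ factor_critical k G ->
  exists S : {set G}, k <= #|S| /\ #|S| - k + 2 <= #|components (@adj G) (~: S)|.
Proof.
move=> kG ev nfc; apply: contrapT => noS; apply: nfc => S0 cS0.
have [U sU HU] := tutte_berge (@adj_sym G) (@adj_irr G) (~: S0).
have [f fM] := max_matching_exists (@adj G) (~: S0).
have fA : matching_on (@adj G) (~: S0) f by case/max_matchingP: fM.
apply: (perfect_matching_of_involution fA); apply/eqP; rewrite -cards_eq0.
apply: contraT => f0; exfalso; apply: noS; exists (S0 :|: U).
have dis : S0 :&: U = set0.
  by apply/setP => x; rewrite !inE; apply/negP => /andP[xS /(subsetP sU)]; rewrite inE xS.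
have cSU : #|S0 :|: U| = k + #|U| by rewrite cardsU dis cards0 subn0 cS0.
have eD : ~: S0 :\: U = ~: (S0 :|: U) by rewrite setDE setCU.
have := HU f fM; rewrite eD => le1.
have le2 : #|odd_components (@adj G) (~: (S0 :|: U))| <= #|components (@adj G) (~: (S0 :|: U))|.
  by apply: subset_leq_card; apply/subsetP => C; case/setIdP.
have := odd_card_odd_components (@adj_sym G) (~: (S0 :|: U)).
have := cardsC (S0 :|: U); rewrite cSU => cC od.
split; first by lia.
lia.
Qed.

(** Elements of equal rank in the enumerations of corresponding fibres are paired. *)
Lemma class_bijection (A B I : finType) (cA : A -> I) (cB : B -> I) :
  (forall i, #|[set x | cA x == i]| = #|[set y | cB y == i]|) ->
  exists2 f : A -> B, bijective f & forall x, cB (f x) = cA x.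
Proof.
move=> eqc.
have eqs i : size (enum [set x | cA x == i]) = size (enum [set y | cB y == i]).
  by rewrite -!cardE.
have mA x : x \in enum [set z | cA z == cA x] by rewrite mem_enum inE.
have lt x : index x (enum [set z | cA z == cA x]) < size (enum [set y | cB y == cA x]).
  by rewrite -eqs index_mem.
have B0 (x : A) : B by case: (enum [set y | cB y == cA x]) (lt x) => // b.
pose f x := nth (B0 x) (enum [set y | cB y == cA x]) (index x (enum [set z | cA z == cA x])).
have fc x : cB (f x) = cA x.
  by have := mem_nth (B0 x) (lt x); rewrite mem_enum inE => /eqP.
exists f => //; apply: inj_card_bij.
  move=> x y fxy; have cxy : cA x = cA y by rewrite -!fc fxy.
  move: fxy; rewrite /f (set_nth_default (B0 y) _ (lt x)) cxy.
  move/eqP; rewrite nth_uniq ?enum_uniq -?cxy //; last by rewrite cxy.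
  move/eqP => E; rewrite -(nth_index x (mA x)) E cxy.
  by rewrite (nth_index x (mA y)).
have cardE' (C : finType) (c : C -> I) : #|C| = \sum_i #|[set x | c x == i]|.
  rewrite -sum1_card (partition_big c xpredT) //=; apply: eq_bigr => i _.
  by rewrite -sum1_card; apply: eq_bigl => x; rewrite inE.
rewrite (cardE' _ cA) (cardE' _ cB) leq_eqVlt; apply/orP; left; apply/eqP.
by apply: eq_bigr => i _; rewrite eqc.
Qed.

Local Open Scope ring_scope.

(** * Perron comparison for the signless Laplacian *)

Section SignlessLaplacian.
Variable R : realType.

(** The operator $D + A$, edge by edge. A bare relation lets it apply to [closure_adj] as well,
    which is not packaged as an [sgraph]. *)
Definition slap (T : finType) (e : rel T) (w : T -> R) (x : T) : R :=
  \sum_(y | e x y) (w x + w y).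

(** The equality condition later turns a missing edge into a strict inequality. *)
Lemma slap_sub (T : finType) (e e' : rel T) (w : T -> R) (x : T) :
  (forall y, 0 < w y) -> (forall y, e x y -> e' x y) ->
  slap e w x <= slap e' w x ?= iff [forall y, e' x y ==> e x y].
Proof.
move=> w0 ee'; rewrite /slap; split.
  rewrite [leRHS](bigID (e x)) /= [leLHS](eq_bigl (fun y => e' x y && e x y)).
    by rewrite lerDl sumr_ge0 // => y _; rewrite ltW // addr_gt0.
  by move=> y; have := ee' y; case: (e x y) => // [->|] //; rewrite andbF.
rewrite [X in _ == X](bigID (e x)) /=.
rewrite [X in X == _](eq_bigl (fun y => e' x y && e x y)); last first.
  by move=> y; have := ee' y; case: (e x y) => // [->|] //; rewrite andbF.
rewrite eq_sym addrC -subr_eq0 addrK psumr_eq0; last first.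
  by move=> y _; rewrite ltW // addr_gt0.
apply/allP/forallP => [H y|H y _].
  have := H y (mem_index_enum y); rewrite gt_eqF ?addr_gt0 // implybF.
  by rewrite negb_and negbK implybE.
by have := H y; rewrite gt_eqF ?addr_gt0 // implybF negb_and negbK implybE.
Qed.

Lemma slap_deg (G : sgraph) (f : G -> R) x :
  slap (@adj G) f x = (deg x)%:R * f x + \sum_(y | adj x y) f y.
Proof. by rewrite /slap big_split /= sumr_const /deg mulr_natl. Qed.

Lemma mul_signless_laplacian (G : sgraph) (f : G -> R) (j : 'I_#|G|) :
  ((\row_i f (enum_val i)) *m signless_laplacian R G) 0 j = slap (@adj G) f (enum_val j).
Proof.
rewrite mulmxDr !mxE slap_deg; congr (_ + _).
  rewrite (bigD1 j) //= big1 ?addr0 => [|i ij]; rewrite !mxE ?eqxx ?mulr1n 1?mulrC //.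
  by rewrite (negPf ij) mulr0n mul0r.
rewrite [RHS]big_mkcond (reindex (@enum_val G predT)) /=; last first.
  by apply: onW_bij; exact: enum_val_bij.
apply: eq_bigr => i _; rewrite !mxE adj_sym.
by case: adj; rewrite ?mulr1 ?mulr0.
Qed.

Lemma eigenvalue_slapP (G : sgraph) (l : R) :
  eigenvalue (signless_laplacian R G) l <->
  exists2 f : G -> R, (exists x, f x != 0) & forall x, slap (@adj G) f x = l * f x.
Proof.
split=> [/eigenvalueP[u uQ u0]|[f [x fx] fQ]].
  pose f x := u 0 (enum_rank x).
  have uE : u = \row_i f (enum_val i).
    by apply/rowP => i; rewrite mxE /f enum_valK.
  exists f.
    by have /rV0Pn[i ui] := u0; exists (enum_val i); rewrite /f enum_valK.
  move=> x; rewrite -(enum_rankK x) -mul_signless_laplacian -uE uQ.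
  by rewrite mxE /f enum_valK.
apply/eigenvalueP; exists (\row_i f (enum_val i)).
  by apply/rowP => j; rewrite mul_signless_laplacian fQ !mxE.
by apply/rV0Pn; exists (enum_rank x); rewrite mxE enum_rankK.
Qed.

Lemma slap_adjoint (G : sgraph) (f g : G -> R) :
  \sum_x f x * slap (@adj G) g x = \sum_x slap (@adj G) f x * g x.
Proof.
under eq_bigr do rewrite slap_deg mulrDr.
under [RHS]eq_bigr do rewrite slap_deg mulrDl.
rewrite !big_split /=; congr (_ + _).
  by apply: eq_bigr => x _; rewrite mulrCA mulrA.
under eq_bigr do rewrite mulr_sumr big_mkcond /=.
rewrite exchange_big /=; apply: eq_bigr => y _.
rewrite mulr_suml [RHS]big_mkcond /=; apply: eq_bigr => x _.
by rewrite adj_sym; case: ifP.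
Qed.

(** The modulus of an eigenvector works, by the triangle inequality, because the matrix entries are
    nonnegative. *)
Lemma eigenvalue_subsolution (G : sgraph) (l : R) :
  eigenvalue (signless_laplacian R G) l ->
  exists v : G -> R, [/\ exists x, v x != 0, forall x, 0 <= v x
    & forall x, l * v x <= slap (@adj G) v x].
Proof.
case/eigenvalue_slapP=> f [x0 fx0] fQ; exists (fun x => `|f x|); split.
- by exists x0; rewrite normr_eq0.
- by move=> x; rewrite normr_ge0.
move=> x; apply: (@le_trans _ _ `|l * f x|).
  by rewrite normrM ler_wpM2r // ler_norm.
rewrite -fQ !slap_deg; apply: le_trans (ler_normD _ _) _.
by rewrite normrM ger0_norm ?ler0n // lerD2l ler_norm_sum.
Qed.

(** With a subsolution [v] for [l], [l <w, v> <= <w, Q v> = <Q w, v> <= r <w, v>], and [<w, v>] is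
    positive. *)
Lemma eigenvalue_le (G : sgraph) (w : G -> R) (r l : R) :
  (forall x, 0 < w x) -> (forall x, slap (@adj G) w x <= r * w x) ->
  eigenvalue (signless_laplacian R G) l -> l <= r.
Proof.
move=> w0 wQ /eigenvalue_subsolution[v [[x0 vx0] v0 vQ]].
have pos : 0 < \sum_x w x * v x.
  have vpos : 0 < v x0 by rewrite lt0r vx0 v0.
  rewrite (bigD1 x0) //= ltr_pwDl ?mulr_gt0 ?sumr_ge0 //.
  by move=> x _; rewrite mulr_ge0 // ltW.
rewrite -(ler_pM2r pos) !mulr_sumr.
apply: (@le_trans _ _ (\sum_x w x * slap (@adj G) v x)).
  by apply: ler_sum => x _; rewrite mulrCA ler_wpM2l // ltW.
rewrite slap_adjoint; apply: ler_sum => x _.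
by rewrite mulrA ler_wpM2r.
Qed.

(* Pairing a positive supersolution with a nonnegative subsolution forces
   equality in both, except where v vanishes for the former. *)
Lemma perron_comparison (G : sgraph) (w : G -> R) (r : R) :
  (0 < #|G|)%N ->
  (forall x, 0 < w x) -> (forall x, slap (@adj G) w x <= r * w x) ->
  r <= q R G ->
  exists v : G -> R, [/\ exists x, v x != 0,
    forall x, slap (@adj G) w x < r * w x -> v x = 0
    & forall x y, adj x y -> v x = 0 -> v y = 0].
Proof.
move=> G0 w0 wQ rq; have [qeig _] := q_max R G0.
have [v [v_neq0 v0 vQ]] := eigenvalue_subsolution qeig.
have vQ' x : r * v x <= slap (@adj G) v x.
  by apply: le_trans (vQ x); rewrite ler_wpM2r.
(* [a] and [b] are the slacks of the two inequalities: nonnegative, with total zero by symmetry of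
   the operator, hence all zero. *)
pose a x := w x * (slap (@adj G) v x - r * v x).
pose b x := (r * w x - slap (@adj G) w x) * v x.
have a0 x : 0 <= a x by rewrite mulr_ge0 ?subr_ge0 // ltW.
have b0 x : 0 <= b x by rewrite mulr_ge0 ?subr_ge0.
have ab0 : \sum_x (a x + b x) = 0.
  have := slap_adjoint w v; move/eqP; rewrite -subr_eq0 -sumrB => /eqP E.
  rewrite -[RHS]E; apply: eq_bigr => x _; rewrite /a /b; ring.
have ab x : a x = 0 /\ b x = 0.
  move: ab0 => /eqP; rewrite psumr_eq0 => [/allP/(_ x (mem_index_enum x))|y _].
    by rewrite /= paddr_eq0 // => /andP[/eqP-> /eqP->].
  by rewrite addr_ge0.
exists v; split=> // [x wx|x y xy vx].
  have [_ /eqP] := ab x; rewrite mulf_eq0 gt_eqF ?subr_gt0 //=.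
  by move/eqP.
have [/eqP + _] := ab x; rewrite mulf_eq0 gt_eqF //= vx mulr0 subr0 slap_deg vx mulr0 add0r.
by rewrite psumr_eq0 // => /allP/(_ y (mem_index_enum y)) /implyP/(_ xy)/eqP.
Qed.

End SignlessLaplacian.

(** * Estimates for the extremal radius *)

(* Convexity of x / (a - 2 x), made quantitative: the difference of the two
   sides is (#|P| - r) c plus the sum of the secant defects d i. *)
Lemma sum_ratio_le (R : realFieldType) (I : finType) (P : {set I}) (x : I -> R)
    (a p M r : R) :
  0 < p -> p <= M -> 2 * M < a -> r <= #|P|%:R ->
  (forall i, i \in P -> p <= x i <= M) ->
  \sum_(i in P) x i = (r - 1) * p + M ->
  \sum_(i in P) x i / (a - 2 * x i)
    <= (r - 1) * p / (a - 2 * p) + M / (a - 2 * M) ?= iff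
  (#|P|%:R == r) && [forall i in P, (x i == p) || (x i == M)].
Proof.
move=> p0 pM Ma rP xP sx.
have ap : 0 < a - 2 * p by lra.
have aM : 0 < a - 2 * M by lra.
have ax i : i \in P -> 0 < a - 2 * x i by move/xP=> /andP[_]; lra.
have apN : a - 2 * p != 0 by rewrite gt_eqF.
have aMN : a - 2 * M != 0 by rewrite gt_eqF.
(* [c] is minus the value at 0 of the chord of [x / (a - 2 * x)] through [p] and [M]; each index
   beyond [r] lowers the sum of chord values by [c]. *)
pose c := 2 * M * p / ((a - 2 * p) * (a - 2 * M)).
pose d i := 2 * a * ((x i - p) * (M - x i))
            / ((a - 2 * p) * (a - 2 * M) * (a - 2 * x i)).
have c0 : 0 < c by rewrite divr_gt0 ?mulr_gt0 //; lra.
have d0 i : i \in P -> 0 <= d i.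
  move=> iP; have := xP i iP => /andP[x1 x2]; have axi := ax i iP.
  rewrite divr_ge0 ?mulr_ge0 ?subr_ge0 //; try lra.
have key : (r - 1) * p / (a - 2 * p) + M / (a - 2 * M)
    = \sum_(i in P) x i / (a - 2 * x i)
      + ((#|P|%:R - r) * c + \sum_(i in P) d i).
  (* Adding its defect moves a term onto the chord, which is affine, so only the number of terms and
     their total matter. *)
  have E : \sum_(i in P) (x i / (a - 2 * x i) + d i) = \sum_(i in P)
      (p / (a - 2 * p) + a / ((a - 2 * M) * (a - 2 * p)) * (x i - p)).
    apply: eq_bigr => i iP; rewrite /d.
    have axi : a - 2 * x i != 0 by rewrite gt_eqF ?ax.
    by field; rewrite apN aMN axi.
  rewrite addrCA -big_split /= E big_split /= sumr_const -[X in _ + (_ + X)]mulr_sumr sumrB.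
  rewrite sumr_const sx.
  by rewrite /c; field; rewrite apN aMN.
have c1 : 0 <= (#|P|%:R - r) * c by rewrite mulr_ge0 ?subr_ge0 ?(ltW c0).
have d1 : 0 <= \sum_(i in P) d i by apply: sumr_ge0.
rewrite key; split; first by rewrite lerDl addr_ge0.
rewrite eq_sym addrC -subr_eq0 addrK paddr_eq0 //.
rewrite mulf_eq0 subr_eq0 (gt_eqF c0) orbF; congr (_ && _).
rewrite psumr_eq0 //; apply/allP/forall_inP => [H i iP|H i _].
  have := H i (mem_index_enum i); rewrite iP /= mulf_eq0 invr_eq0.
  rewrite [X in _ || X]gt_eqF ?mulr_gt0 ?ax // orbF mulf_eq0 gt_eqF /=; last lra.
  by rewrite mulf_eq0 !subr_eq0 [M == _]eq_sym.
apply/implyP => iP; rewrite /d.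
by case/orP: (H i iP) => /eqP ->; rewrite subrr ?mulr0 mul0r // mulr0 mul0r.
Qed.

(* m is the size of the large clique of the extremal graph and D the distance
   from rho to the diagonal entry of that clique in the quotient matrix. *)
Record extremal_radius (R : realFieldType) (n d t m rho D : R) : Prop := {
  er_m : m = n - d - t;
  er_D : D = rho - (2 * n - d - 2 * t - 2);
  er_d : 1 <= d;
  er_t : 2 <= t <= d + 1;
  er_n : 7 * d + 2 * t + 10 <= n;
  er_D0 : 0 < D;
  er_rho : rho = n + d - 2 + t * d / (rho - d) + m * d / D }.

Section Estimates.
Variable R : realFieldType.
Variables n d t m rho D : R.

(** [er_rho] reads [m * d / D = m + D - d - t - t * d / (rho - d)]. If [D <= d], the left side is at
    least [m] and the right side below it; if [D >= 4 / 3 * d], the left side is at most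
    [3 / 4 * m], too little for such [n]. *)
Lemma rho_gap : extremal_radius n d t m rho D ->
  d < D < 4 / 3 * d.
Proof.
case=> mE DE d1 /andP[t2 td] n_large D0 rhoE.
have rd : 12 * d < rho - d by lra.
have rd0 : 0 < rho - d by lra.
set X := t * d / (rho - d) in rhoE.
set Y := m * d / D in rhoE.
have XE : X * (rho - d) = t * d by rewrite mulfVK // gt_eqF.
have YE : Y * D = m * d by rewrite mulfVK // gt_eqF.
have X0 : 0 <= X by rewrite divr_ge0 ?mulr_ge0 //; lra.
have X1 : X <= t / 12.
  rewrite ler_pdivrMr // ; nra.
apply/andP; split; rewrite ltNge; apply/negP => H.
  have : m <= Y by rewrite ler_pdivlMr // ler_pM2l //; lra.
  by lra.
have : Y <= 3 / 4 * m by rewrite ler_pdivrMr //; nra.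
by lra.
Qed.

Lemma rho_ge : extremal_radius n d t m rho D ->
  2 * n - 2 * t - 2 < rho.
Proof. by move=> H; have /andP[+ _] := rho_gap H; rewrite (er_D H); lra. Qed.

(** The case of equality, [|S| = d]: [t] singletons and one component of size [m]. *)
Lemma rho_eq : extremal_radius n d t m rho D ->
  n + d - 2 + d * (t * 1 / (rho - d + 2 - 2 * 1)
   + m / (rho - d + 2 - 2 * m)) = rho.
Proof.
move=> H; have r1 := rho_ge H; move: H.
case=> mE DE d1 /andP[t2 td] n_large D0 rhoE; rewrite [RHS]rhoE.
have -> : rho - d + 2 - 2 * 1 = rho - d by ring.
have -> : rho - d + 2 - 2 * m = D by rewrite DE mE; ring.
field; rewrite !gt_eqF //; lra.
Qed.

(** Here [|S| = d + h], with [t + h] singletons and one component of size [m - 2 * h]. The term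
    [|S|] grows by [h] and the singletons add at most [h / 2], but the large component loses more
    than [3 / 2 * h]. *)
Lemma large_barrier_lt (h : R) : extremal_radius n d t m rho D ->
  0 < h -> 1 <= m - 2 * h ->
  0 < rho - (d + h) + 2 - 2 * (m - 2 * h) /\
  n + (d + h) - 2 + (d + h) * ((t + h) * 1 / (rho - (d + h) + 2 - 2 * 1)
   + (m - 2 * h) / (rho - (d + h) + 2 - 2 * (m - 2 * h))) < rho.
Proof.
move=> H; have r1 := rho_ge H; have /andP[D1 D2] := rho_gap H; move: H.
case=> mE DE d1 /andP[t2 td] n_large D0 rhoE h0 hm.
have -> : rho - (d + h) + 2 - 2 * 1 = rho - d - h by ring.
have -> : rho - (d + h) + 2 - 2 * (m - 2 * h) = D + 3 * h by rewrite DE mE; ring.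
split; first by lra.
have rd0 : 0 < rho - d by lra.
have E0 : 0 < rho - d - h by lra.
set X := t * d / (rho - d) in rhoE.
set Y := m * d / D in rhoE.
have XE : X * (rho - d) = t * d by rewrite mulfVK // gt_eqF.
have X0 : 0 <= X by rewrite divr_ge0 ?mulr_ge0 //; lra.
have X1 : X <= t / 12 by rewrite ler_pdivrMr //; nra.
have gain : (d + h) * ((t + h) * 1 / (rho - d - h)) - X <= h / 2.
  have -> : (d + h) * ((t + h) * 1 / (rho - d - h)) - X
            = h * ((d + t + h + X) / (rho - d - h)).
    by rewrite /X; field; rewrite !gt_eqF.
  rewrite ler_pM2l // ler_pdivrMr //; lra.
have loss : 3 / 2 * h < Y - (d + h) * ((m - 2 * h) / (D + 3 * h)).
  have D3 : 0 < D + 3 * h by lra.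
  have -> : Y - (d + h) * ((m - 2 * h) / (D + 3 * h))
     = h * ((3 * d * m - D * m + 2 * D * d + 2 * D * h) / (D * (D + 3 * h))).
    by rewrite /Y; field; rewrite !gt_eqF.
  rewrite [ltLHS]mulrC ltr_pM2l // ltr_pdivlMr ?mulr_gt0 //.
  have P1 : 0 <= (4 * d - 3 * D) * m by rewrite mulr_ge0; lra.
  have P2 : 0 <= (4 * d - 3 * D) * D by rewrite mulr_ge0; lra.
  have P3 : 0 <= D * (m - 1 - 2 * h) by rewrite mulr_ge0; lra.
  nra.
rewrite mulrDr; lra.
Qed.

(** Here [|S| = d - h], with [j] components of least size [h + 1] and one of size [m - h * (j - 2)].
    For [j = 1] the latter exceeds [m], but its contribution grows by at most [h], which the
    decrease of [|S|] offsets. *)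
Lemma small_barrier_lt (h j : R) : extremal_radius n d t m rho D ->
  0 < h -> h <= d -> h + j = t ->
  j = 1 \/ 2 <= j -> h + 1 <= m - h * (j - 2) ->
  0 < rho - (d - h) + 2 - 2 * (m - h * (j - 2)) /\
  n + (d - h) - 2 + (d - h) * (j * (h + 1) / (rho - (d - h) + 2 - 2 * (h + 1))
   + (m - h * (j - 2)) / (rho - (d - h) + 2 - 2 * (m - h * (j - 2)))) < rho.
Proof.
move=> H; have r1 := rho_ge H; have /andP[D1 D2] := rho_gap H; move: H.
case=> mE DE d1 /andP[t2 td] n_large D0 rhoE h0 hd hj j12 hM.
have -> : rho - (d - h) + 2 - 2 * (h + 1) = rho - d - h by ring.
have -> : rho - (d - h) + 2 - 2 * (m - h * (j - 2)) = D + h * (2 * j - 3).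
  by rewrite DE mE -hj; ring.
have rd0 : 0 < rho - d by lra.
have E0 : 0 < rho - d - h by lra.
pose u := d / (rho - d).
have uE : u * (rho - d) = d by rewrite mulfVK // gt_eqF.
have u0 : 0 < u by rewrite divr_gt0 //; lra.
have XE : t * d / (rho - d) = (h + j) * u by rewrite -hj mulrA.
set Y := m * d / D in rhoE; rewrite XE in rhoE.
have u_gt : (d - h) / (rho - d - h) < u.
  have u1 : u < 1 by rewrite ltr_pdivrMr //; lra.
  have uh : u * h < 1 * h by rewrite ltr_pM2r.
  by rewrite ltr_pdivrMr // mulrDr uE; lra.
case: j12 => [j1|j2].
  have -> : D + h * (2 * j - 3) = D - h by rewrite j1; ring.
  have -> : m - h * (j - 2) = m + h by rewrite j1; ring.
  have Dh : 0 < D - h by lra.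
  split=> //.
  have y_le : (d - h) / (D - h) <= d / D.
    rewrite ler_pdivrMr // mulrAC ler_pdivlMr //; nra.
  have YE : Y = d / D * m by rewrite /Y; ring.
  have y1 : (d - h) / (D - h) <= 1 by rewrite ler_pdivrMr //; lra.
  have a1 : (d - h) / (rho - d - h) * (h + 1) < u * (h + 1).
    by rewrite ltr_pM2r //; lra.
  have a2 : (d - h) / (D - h) * m <= d / D * m by rewrite ler_wpM2r //; lra.
  have a3 : (d - h) / (D - h) * h <= 1 * h by rewrite ler_wpM2r //; lra.
  have -> : (d - h) * (j * (h + 1) / (rho - d - h) + (m + h) / (D - h))
     = (d - h) / (rho - d - h) * (h + 1) + (d - h) / (D - h) * m
       + (d - h) / (D - h) * h by rewrite j1; ring.
  by rewrite j1 in rhoE; lra.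
set b := 2 * j - 3.
have b1 : 1 <= b by rewrite /b; lra.
have hb : 0 < h * b by rewrite mulr_gt0 //; lra.
have Dhb : 0 < D + h * b by lra.
split=> //.
have hj0 : 0 <= h * (j - 2) by rewrite mulr_ge0; lra.
have a1 : (d - h) / (rho - d - h) * (j * (h + 1)) <= u * (j * (h + 1)).
  by rewrite ler_pM2r ?mulr_gt0 ?(ltW u_gt) //; lra.
have a2 : (d - h) * ((m - h * (j - 2)) / (D + h * b)) <= (d - h) * (m / (D + h * b)).
  by rewrite ler_wpM2l ?subr_ge0 // ler_pM2r ?invr_gt0 //; lra.
have YE : Y - (d - h) * (m / (D + h * b))
   = h * (m * (d * b + D) / (D * (D + h * b))).
  by rewrite /Y; field; rewrite !gt_eqF.
(* The small components cost at most [h * (u * (j - 1))] more than the [t] singletons, as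
   [j * (h + 1) - t = h * (j - 1)]; the loss of the large one covers this. *)
have a3 : u * (j - 1) <= m * (d * b + D) / (D * (D + h * b)).
  (* [hM] keeps [h * (j - 2)] below [m], hence [h * b] linear in [n]. *)
  have big : D * (D + h * b) <= m * (rho - d).
    apply: (@le_trans _ _ ((n / 5) * (3 * n))).
      by apply: ler_pM; rewrite /b; lra.
    have -> : n / 5 * (3 * n) = (3 / 5 * n) * n by field.
    by apply: ler_pM; lra.
  rewrite ler_pdivlMr ?mulr_gt0 //.
  apply: (@le_trans _ _ (u * b * (m * (rho - d)))).
    have j1 : 0 <= j - 1 by lra.
    apply: ler_pM => //; first exact: mulr_ge0 (ltW u0) j1.
      by rewrite mulr_ge0; lra.
    by rewrite ler_pM2l // /b; lra.
  have -> : u * b * (m * (rho - d)) = m * (d * b) by rewrite -[in RHS]uE; ring.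
  by rewrite ler_pM2l; lra.
have a4 : h * (u * (j - 1)) <= h * (m * (d * b + D) / (D * (D + h * b))).
  by rewrite ler_pM2l.
have -> : (d - h) * (j * (h + 1) / (rho - d - h) + (m - h * (j - 2)) / (D + h * b))
   = (d - h) / (rho - d - h) * (j * (h + 1))
     + (d - h) * ((m - h * (j - 2)) / (D + h * b)) by ring.
lra.
Qed.

End Estimates.

(** * The extremal graph *)

Definition extremal_class (n d k : nat) (x : extremal n d k) : option bool :=
  match x with
  | inl _ => None
  | inr (inl _) => Some false
  | inr (inr _) => Some true
  end.

Definition class_adj (i j : option bool) : bool :=
  if i is Some a then if j is Some b then a && b else true else true.

Lemma extremal_adjE (n d k : nat) (x y : extremal n d k) :
  adj x y = (x != y) && class_adj (extremal_class x) (extremal_class y).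
Proof.
case: x => [x|[x|x]]; case: y => [y|[y|y]]; rewrite ?andbT ?andbF //=.
by rewrite /copies_adj /= /complete_adj !ord1 eqxx andbF.
Qed.

Lemma card_extremal_class (n d k : nat) (i : option bool) :
  #|[set x | extremal_class (x : extremal n d k) == i]| =
  match i with
  | None => d
  | Some false => (d - k + 1)%N
  | Some true => (n - 2 * d + k - 1)%N
  end.
Proof.
rewrite -sum1_card (eq_bigl (fun x => extremal_class x == i)) => [|x]; last by rewrite inE.
rewrite !big_sumType /=.
case: i => [[]|] /=; rewrite !sum_nat_const !muln1 ?(@eq_card0 _ xpred0) ?add0n ?addn0 //.
- exact: card_ord.
- by have := card_prod 'I_(d - k + 1) 'I_1; rewrite !card_ord muln1.
- exact: card_ord.
Qed.

Section ExtremalGraph.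
Variables (R : realType) (n d k : nat).
Hypotheses (d_gt0 : (0 < d)%N) (k_lt : (k < d)%N)
  (n_large : (9 * d - 2 * k + 12 <= n)%N).

Local Notation E := (extremal n d k).
Local Notation nR := (n%:R : R).
Local Notation dR := (d%:R : R).
Local Notation kR := (k%:R : R).
Local Notation tR := (dR - kR + 1).
Local Notation mR := (nR - dR - tR).
Local Notation cR := (2 * nR - dR - 2 * tR - 2).

Definition class_weight (a b c : R) (x : E) : R :=
  match extremal_class x with
  | None => a
  | Some false => b
  | Some true => c
  end.

(** The classes form an equitable partition; these are the rows of its quotient matrix. *)
Lemma slap_class_weight (a b c : R) (x : E) :
  slap (@adj E) (class_weight a b c) x =
  match extremal_class x with
  | None => (dR - 1) * (a + a) + tR * (a + b) + mR * (a + c)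
  | Some false => dR * (b + a)
  | Some true => dR * (c + a) + (mR - 1) * (c + c)
  end.
Proof.
have tE : (d - k + 1)%:R = tR :> R by rewrite natrD natrB // ltnW.
have mE : (n - 2 * d + k - 1)%:R = mR :> R.
  rewrite natrB; last lia; rewrite natrD natrB; last lia.
  by rewrite natrM; ring.
have ordC1 N (y : 'I_N) : #|[pred z | y != z]|%:R = N%:R - 1 :> R.
  have := cardC1 y; rewrite card_ord (eq_card (B := [pred z | y != z])) => [->|z]; last first.
    by rewrite !inE eq_sym.
  by case: N y => [[]//|N] _ /=; rewrite -natr1 addrK.
rewrite /slap /class_weight !big_sumType /=.
case: x => [x|[x|x]] /=; rewrite ?big_pred0_eq ?addr0 ?add0r.
- rewrite !sumr_const -!(mulr_natl (_ + _)) card_prod !card_ord muln1 tE mE ordC1.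
  by rewrite addrA.
- rewrite [X in _ + X]big_pred0 => [|y]; last first.
    by rewrite /copies_adj /= /complete_adj !ord1 eqxx andbF.
  by rewrite addr0 sumr_const -(mulr_natl (_ + _)) card_ord.
- by rewrite !sumr_const -!(mulr_natl (_ + _)) card_ord ordC1 mE.
Qed.

(** The characteristic polynomial of the quotient matrix; dividing its equation by
    [(x - dR) * (x - cR)] gives [er_rho]. *)
Lemma g_polyE (x : R) : g_poly nR dR kR x =
  (x - (nR + dR - 2)) * (x - dR) * (x - cR) - tR * dR * (x - cR) - mR * dR * (x - dR).
Proof. by rewrite /g_poly; ring. Qed.

Lemma real_bounds : [/\ 1 <= dR, 2 <= tR <= dR + 1 & 7 * dR + 2 * tR + 10 <= nR].
Proof.
have k0 : 0 <= kR by rewrite ler0n.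
have d1 : 1 <= dR by rewrite ler1n.
have kd : kR + 1 <= dR by rewrite natr1 ler_nat.
have nb : 9 * dR + 12 <= nR + 2 * kR.
  by rewrite -!natrM -!natrD ler_nat; lia.
split=> //; [apply/andP; split|]; lra.
Qed.

Lemma root_extremal_radius (x : R) : cR < x -> g_poly nR dR kR x = 0 ->
  extremal_radius nR dR tR mR x (x - cR).
Proof.
move=> cx; rewrite g_polyE => gx; have [d1 t1 n1] := real_bounds.
have /andP[t2 t3] := t1.
have xc : 0 < x - cR by lra.
have xd : 0 < x - dR by lra.
split=> //.
have xcN : x - cR != 0 by rewrite gt_eqF.
have xdN : x - dR != 0 by rewrite gt_eqF.
apply: (mulIf (mulf_neq0 xdN xcN)); apply/eqP; rewrite -subr_eq0; apply/eqP.
rewrite -[RHS]gx; field; by rewrite xcN xdN.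
Qed.

(** With value 1 on the dominating clique, the rows of the other classes force their values, and the
    remaining row is [er_rho]. Positivity comes from [cR < x]. *)
Lemma extremal_eigenvector (x : R) : cR < x -> g_poly nR dR kR x = 0 ->
  let w := class_weight 1 (dR / (x - dR)) (dR / (x - cR)) in
  (forall v, 0 < w v) /\ forall v, slap (@adj E) w v = x * w v.
Proof.
move=> cx gx w; have [d1 /andP[t2 t3] n1] := real_bounds.
have [_ _ _ _ _ xc xE] := root_extremal_radius cx gx.
have xd : 0 < x - dR by lra.
have xcN : x - cR != 0 by rewrite gt_eqF.
have xdN : x - dR != 0 by rewrite gt_eqF.
split=> v; first by rewrite /w /class_weight; case: extremal_class => [[]|] //;
  rewrite divr_gt0 //; lra.
rewrite slap_class_weight /w /class_weight; case: extremal_class => [[]|].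
- by field.
- by field.
by rewrite [RHS]mulr1 [RHS]xE; field; rewrite xcN xdN.
Qed.

Lemma card_extremal_gt0 : (0 < #|E|)%N.
Proof. by apply/card_gt0P; exists (inl (Ordinal d_gt0)). Qed.

(** Intermediate values between [cR], where only [- mR * dR * (cR - dR)] survives, and [2 * nR]. *)
Lemma g_poly_root : exists2 x : R, cR < x & g_poly nR dR kR x = 0.
Proof.
have [d1 /andP[t2 t3] n1] := real_bounds.
pose p := ('X - (nR + dR - 2)%:P) * ('X - dR%:P) * ('X - cR%:P)
          - (tR * dR)%:P * ('X - cR%:P) - (mR * dR)%:P * ('X - dR%:P).
have pE x : p.[x] = g_poly nR dR kR x by rewrite g_polyE /p !hornerE.
have c_lt : p.[cR] < 0.
  rewrite pE g_polyE subrr !mulr0 subr0 sub0r oppr_lt0 mulr_gt0 ?mulr_gt0 //; lra.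
have n_ge : 0 <= p.[2 * nR].
  rewrite pE g_polyE.
  have -> : 2 * nR - cR = dR + 2 * tR + 2 by ring.
  have -> : 2 * nR - (nR + dR - 2) = mR + (tR + 2) by ring.
  set t := tR in t2 t3 n1 *; set m := mR.
  have mE : m = nR - dR - t by [].
  have P1 : 0 <= m * (2 * nR - dR) * (2 * t + 2).
    by rewrite !mulr_ge0 //; lra.
  have P2 : 0 <= (dR + 2 * t + 2) * (2 * (2 * nR - dR) + t * (2 * nR - 2 * dR)).
    by rewrite mulr_ge0 ?addr_ge0 ?mulr_ge0 //; lra.
  lra.
have cn : cR <= 2 * nR by lra.
have p_sign : p.[cR] <= 0 <= p.[2 * nR] by rewrite (ltW c_lt) n_ge.
have [x /andP[cx xn] /rootP px] := poly_ivt cn p_sign.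
exists x; last by rewrite -pE.
by rewrite lt_neqAle cx andbT; apply: contraTneq c_lt => ->; rewrite px ltxx.
Qed.

(** The eigenvalue of a positive eigenvector bounds all others. As this covers every root beyond
    [cR], there is only one, which settles the largest-root claim. *)
Lemma q_extremalE (x : R) : cR < x -> g_poly nR dR kR x = 0 -> q R E = x.
Proof.
move=> cx gx; have [w0 wE] := extremal_eigenvector cx gx.
have [qeig qub] := q_max R card_extremal_gt0; apply/le_anti/andP; split.
  by apply: (eigenvalue_le w0) qeig => v; rewrite wE.
apply: qub; apply/eigenvalue_slapP; exists (class_weight 1 (dR / (x - dR)) (dR / (x - cR))) => //.
by exists (inl (Ordinal d_gt0)); rewrite gt_eqF.
Qed.

Lemma q_extremal_radius : extremal_radius nR dR tR mR (q R E) (q R E - cR).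
Proof.
have [x cx gx] := g_poly_root.
by rewrite (q_extremalE cx gx); apply: root_extremal_radius.
Qed.

Lemma q_extremal_largest_root : is_largest_root (g_poly nR dR kR) (q R E).
Proof.
have [x cx gx] := g_poly_root; have qx := q_extremalE cx gx.
split=> [|y gy]; first by rewrite qx.
rewrite qx leNgt; apply/negP => xy.
have := q_extremalE (lt_trans cx xy) gy; rewrite qx => xy'.
by rewrite xy' ltxx in xy.
Qed.

End ExtremalGraph.

(** * Barriers *)

Section Barrier.
Variables (R : realType) (G : sgraph) (S : {set G}) (rho : R).

Local Notation B := (~: S).
Local Notation s := (#|S|%:R : R).
Local Notation cmp := (component (@adj G) B).
Local Notation cmps := (components (@adj G) B).

(* The largest graph with the same barrier. *)
Definition closure_adj : rel G := fun x y =>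
  (x != y) && [|| x \in S, y \in S | conn (@adj G) B x y].

(** On a component of size [p] the value [w] solves [s * (w + 1 / s) + 2 * (p - 1) * w = rho *
    w]. *)
Definition barrier_weight (x : G) : R :=
  if x \in S then s^-1 else (rho - s + 2 - 2 * #|cmp x|%:R)^-1.

Lemma adj_closure x y : adj x y -> closure_adj x y.
Proof.
move=> xy; rewrite /closure_adj; apply/andP; split.
  by apply: contraTneq xy => ->; rewrite adj_irr.
have [//|xS] := boolP (x \in S); have [//|yS] := boolP (y \in S).
by apply: connect1; rewrite /= !inE xS yS.
Qed.

(** The neighbours of [x] lie in [S] or in its component, which also contains [x]. If [d <= #|S|],
    truncation leaves the bound 1. *)
Lemma component_size_ge d x : (forall y : G, (d <= deg y)%N) -> x \notin S ->
  ((d - #|S|).+1 <= #|cmp x|)%N.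
Proof.
move=> dG xS; have xB : x \in cmp x by rewrite mem_component // inE.
have le1 : (#|[pred y | adj x y]| <= #|S :|: cmp x :\ x|)%N.
  apply: subset_leq_card; apply/subsetP => y; rewrite inE => /adj_closure.
  case/andP=> xy; rewrite (negPf xS) /= !inE => /orP[->//|cxy].
  by case: (y \in S); rewrite // eq_sym xy cxy.
have [le2 _] := leq_card_setU S (cmp x :\ x).
have := leq_trans (leq_trans (dG x) le1) le2.
by rewrite (cardsD1 x (cmp x)) xB; lia.
Qed.

Lemma sum_card_components : \sum_(C in cmps) #|C| = (#|G| - #|S|)%N.
Proof.
rewrite -(card_partition (partition_components (@adj_sym G) B)).
by rewrite -(cardsC S) addKn.
Qed.

Lemma sum_barrier_weight :
  \sum_(x in B) barrier_weight x =
  \sum_(C in cmps) #|C|%:R / (rho - s + 2 - 2 * #|C|%:R).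
Proof.
rewrite (set_partition_big _ (partition_components (@adj_sym G) B)) /=.
apply: eq_bigr => C CP.
rewrite (eq_bigr (fun=> (rho - s + 2 - 2 * #|C|%:R)^-1)).
  by rewrite sumr_const -[LHS]mulr_natl.
move=> x xC; have xB : x \in B.
  by case/componentsP: CP xC => z _ -> /setIdP[].
rewrite /barrier_weight; move: xB; rewrite inE => /negPf ->.
by rewrite -(component_eq (@adj_sym G) CP xC).
Qed.

(** [- 1 + s / s] vanishes unless [S] is empty; then [s / s = 0], and the value is strictly below
    [rho * barrier_weight x]. *)
Lemma slap_closure_out x : x \notin S -> 0 < rho - s + 2 - 2 * #|cmp x|%:R ->
  slap closure_adj barrier_weight x = rho * barrier_weight x - 1 + s / s.
Proof.
move=> xS; set z := rho - _ + _ - _ => z0.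
have wx : barrier_weight x = z^-1 by rewrite /barrier_weight (negPf xS).
rewrite /slap (bigID (mem S)) /=.
rewrite (eq_bigl (fun y => y \in S)); last first.
  move=> y /=; rewrite /closure_adj (negPf xS) /=; case yS : (y \in S) => /=.
    by have -> : x != y by apply: contraNneq xS => ->.
  by rewrite andbF.
rewrite (eq_bigr (fun=> z^-1 + s^-1)); last first.
  by move=> y yS; rewrite wx /barrier_weight yS.
rewrite [X in _ + X](eq_bigl (fun y => y \in cmp x :\ x)); last first.
  move=> y /=; rewrite /closure_adj !inE (negPf xS) /= [y == _]eq_sym.
  by case: (y \in S); rewrite /= ?andbF ?andbT.
rewrite [X in _ + X](eq_bigr (fun=> z^-1 + z^-1)); last first.
  move=> y; rewrite !inE => /and3P[_ yS xy]; rewrite wx /barrier_weight (negPf yS).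
  have -> // : cmp y = cmp x.
  symmetry; apply: (component_eq (@adj_sym G)); last by rewrite !inE yS.
  by apply: component_components; rewrite inE.
rewrite !sumr_const -!(mulr_natl (_ + _)) wx.
have -> : #|cmp x :\ x|%:R = #|cmp x|%:R - 1 :> R.
  by rewrite (cardsD1 x (cmp x)) mem_component ?inE // add1n -natr1 addrK.
have zN : z != 0 by rewrite gt_eqF.
have -> : rho * z^-1 - 1 = (rho - z) * z^-1 by rewrite mulrBl mulfV.
by rewrite /z; ring.
Qed.

Lemma slap_closure_in x : x \in S ->
  slap closure_adj barrier_weight x * s = #|G|%:R + s - 2 +
    s * \sum_(C in cmps) #|C|%:R / (rho - s + 2 - 2 * #|C|%:R).
Proof.
move=> xS.
have s0 : s != 0 by rewrite pnatr_eq0 -lt0n; apply/card_gt0P; exists x.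
rewrite /slap (bigID (mem S)) /=.
rewrite (eq_bigl (fun y => y \in S :\ x)); last first.
  by move=> y /=; rewrite /closure_adj xS /= andbT !inE [y == _]eq_sym.
rewrite (eq_bigr (fun=> s^-1 + s^-1)); last first.
  by move=> y /setD1P[_ yS]; rewrite /barrier_weight xS yS.
rewrite [X in _ + X](eq_bigl (fun y => y \in B)); last first.
  move=> y /=; rewrite /closure_adj xS /= andbT !inE.
  by case: eqP => //= <-; rewrite xS.
rewrite [X in _ + X]big_split /= sum_barrier_weight [X in X + _]sumr_const.
have -> : \sum_(y in B) barrier_weight x = (#|G|%:R - s) * s^-1.
  rewrite sumr_const {1}/barrier_weight xS -[LHS]mulr_natl; congr (_ * _).
  by apply/eqP; rewrite eq_sym subr_eq -natrD addnC cardsC.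
rewrite -(mulr_natl (s^-1 + s^-1)).
have -> : #|S :\ x|%:R = s - 1 by rewrite [in RHS](cardsD1 x S) xS add1n -natr1 addrK.
by field.
Qed.

End Barrier.

(** * Component sizes of a barrier and the resulting bound by [rho] *)

Section BarrierBound.
Variables (R : realType) (G : sgraph) (S : {set G}) (n d k : nat).
Hypotheses (nG : #|G| = n) (d_gt0 : (0 < d)%N) (k_lt : (k < d)%N)
  (n_large : (9 * d - 2 * k + 12 <= n)%N)
  (dG : forall x : G, (d <= deg x)%N)
  (kS : (k <= #|S|)%N) (cS : (#|S| - k + 2 <= #|components (@adj G) (~: S)|)%N).

Local Notation s := (#|S|%:R : R).
Local Notation cmps := (components (@adj G) (~: S)).
Local Notation rho := (q R (extremal n d k)).
Local Notation p := (d - #|S|).+1.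
(** What remains for one component when [#|S| - k + 1] others have the least possible size [p]. *)
Local Notation M := (n - #|S| - (#|S| - k + 1) * p)%N.

Lemma components_size_ge C : C \in cmps -> (p <= #|C|)%N.
Proof. by case/componentsP=> x xB ->; apply: component_size_ge => //; rewrite inE in xB. Qed.

Lemma sum_components_ge (Q : {set {set G}}) : Q \subset cmps ->
  (#|Q| * p <= \sum_(C in Q) #|C|)%N.
Proof.
move=> sQ; rewrite -sum_nat_const; apply: leq_sum => C /(subsetP sQ).
exact: components_size_ge.
Qed.

Lemma components_size_le C : C \in cmps -> (#|C| <= M)%N.
Proof.
move=> CP; have := sum_card_components S; rewrite nG (big_setD1 C) //=.
have := sum_components_ge (subD1set cmps C).
have := cardsD1 C cmps; rewrite CP add1n => c1 H E.
have : ((#|S| - k + 1) * p <= #|cmps :\ C| * p)%N by apply: leq_mul => //; lia.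
by move/leq_trans/(_ H) => le1; rewrite -E -addnBA // leq_addr.
Qed.

(** The point is that the truncated subtractions in [M] are exact, since [M] is at least the size of
    a component. *)
Lemma sum_components_eq : (\sum_(C in cmps) #|C| = (#|S| - k + 1) * p + M)%N.
Proof.
have [C CP] : exists C, C \in cmps by apply/card_gt0P; lia.
have := components_size_le CP; have := components_size_ge CP.
by rewrite sum_card_components nG; lia.
Qed.

Lemma M_ge : (p <= M)%N.
Proof.
have [C CP] : exists C, C \in cmps by apply/card_gt0P; lia.
exact: leq_trans (components_size_ge CP) (components_size_le CP).
Qed.

(** Below [d] take [h = d - #|S|] and [j = #|S| - k + 1] in [small_barrier_lt]; above,
    [h = #|S| - d] in [large_barrier_lt]; at [d] this is [rho_eq]. *)
Lemma barrier_bound :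
  0 < rho - s + 2 - 2 * M%:R /\
  n%:R + s - 2 + s * ((#|S| - k + 1)%:R * p%:R / (rho - s + 2 - 2 * p%:R)
    + M%:R / (rho - s + 2 - 2 * M%:R)) <= rho ?= iff (#|S| == d).
Proof.
have ER := q_extremal_radius R d_gt0 k_lt n_large.
have /andP[D1 D2] := rho_gap ER; have Mp := M_ge.
have jE : (#|S| - k + 1)%:R = s - k%:R + 1 :> R by rewrite natrD natrB.
have ME : M%:R = n%:R - s - (s - k%:R + 1) * p%:R :> R.
  have le1 : ((#|S| - k + 1) * p <= n - #|S|)%N by lia.
  by rewrite natrB // natrM jE natrB //; lia.
have Mp' : p%:R <= M%:R :> R by rewrite ler_nat.
rewrite jE; case: (ltngtP #|S| d) => [lt|gt|eq].
- have pE : p%:R = d%:R - s + 1 :> R by rewrite -natr1 natrB // ltnW.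
  have h0 : 0 < d%:R - s by rewrite subr_gt0 ltr_nat.
  have hd : d%:R - s <= d%:R by rewrite gerBl ler0n.
  have hj : d%:R - s + (s - k%:R + 1) = d%:R - k%:R + 1 by ring.
  have j12 : s - k%:R + 1 = 1 \/ 2 <= s - k%:R + 1.
    rewrite -jE; move: (kS); rewrite leq_eqVlt => /orP[/eqP->|klt].
      by left; rewrite subnn.
    by right; rewrite ler_nat; lia.
  have := small_barrier_lt ER h0 hd hj j12.
  have -> : d%:R - (d%:R - s) = s by ring.
  have EM : n%:R - d%:R - (d%:R - k%:R + 1) - (d%:R - s) * (s - k%:R + 1 - 2) = M%:R.
    by rewrite ME pE; ring.
  rewrite EM -pE => /(_ Mp')[M0 F0]; split=> //.
  by split; [exact: ltW|rewrite lt_eqF].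
- have pE : p%:R = 1 :> R by have -> : (d - #|S| = 0)%N by lia.
  have h0 : 0 < s - d%:R by rewrite subr_gt0 ltr_nat.
  have EM : n%:R - d%:R - (d%:R - k%:R + 1) - 2 * (s - d%:R) = M%:R.
    by rewrite ME pE; ring.
  rewrite pE in Mp' *; have := large_barrier_lt ER h0; rewrite EM => /(_ Mp').
  have -> : d%:R + (s - d%:R) = s by ring.
  have -> : d%:R - k%:R + 1 + (s - d%:R) = s - k%:R + 1 by ring.
  move=> [M0 F0]; split=> //.
  by split; [exact: ltW|rewrite lt_eqF].
have pE : p%:R = 1 :> R by have -> : (d - #|S| = 0)%N by lia.
have sE : s = d%:R by rewrite eq.
have EM : n%:R - d%:R - (d%:R - k%:R + 1) = M%:R :> R by rewrite ME pE sE; ring.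
have := rho_eq ER; rewrite pE sE EM => F0; split; last by split; rewrite F0 ?eqxx.
have d0 : 0 <= d%:R :> R by rewrite ler0n.
by rewrite -EM; lra.
Qed.

Lemma sum_components_ratio :
  \sum_(C in cmps) #|C|%:R / (rho - s + 2 - 2 * #|C|%:R)
  <= (#|S| - k + 1)%:R * p%:R / (rho - s + 2 - 2 * p%:R)
     + M%:R / (rho - s + 2 - 2 * M%:R) ?= iff
  (#|cmps| == (#|S| - k + 2)%N) &&
  [forall C in cmps, (#|C| == p) || (#|C| == M)].
Proof.
have [M0 _] := barrier_bound; have Mp := M_ge.
have := @sum_ratio_le R _ cmps (fun C => #|C|%:R) (rho - s + 2) p%:R M%:R
  (#|S| - k + 2)%:R.
have -> : (#|S| - k + 2)%:R - 1 = (#|S| - k + 1)%:R :> R.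
  by rewrite addn2 -addn1 natrD addrK addn1.
rewrite eqr_nat (eq_forallb (P2 := fun C => (C \in cmps) ==> (#|C| == p) || (#|C| == M))).
  apply.
  - by rewrite ltr0n.
  - by rewrite ler_nat.
  - by rewrite -subr_gt0.
  - by rewrite ler_nat.
  - by move=> C CP; rewrite !ler_nat components_size_ge ?components_size_le.
  - by rewrite -natr_sum sum_components_eq natrD natrM.
by move=> C; rewrite !eqr_nat.
Qed.

Lemma barrier_value_le :
  n%:R + s - 2 + s * \sum_(C in cmps) #|C|%:R / (rho - s + 2 - 2 * #|C|%:R) <= rho.
Proof.
have [M0 Fle] := barrier_bound; apply: le_trans Fle.1.
by rewrite lerD2l ler_wpM2l ?ler0n // sum_components_ratio.
Qed.

(** Both inequalities leading to [rho] become equalities, and their equality conditions give the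
    claims; a nonempty [S] lets the factor [s] be cancelled. *)
Lemma barrier_value_eq : (0 < #|S|)%N ->
  n%:R + s - 2 + s * \sum_(C in cmps) #|C|%:R / (rho - s + 2 - 2 * #|C|%:R) = rho ->
  [/\ #|S| = d, #|cmps| = (d - k + 2)%N & forall C, C \in cmps -> #|C| = 1%N \/ #|C| = M].
Proof.
move=> S0 E; have [M0 Fle] := barrier_bound.
have le1 := sum_components_ratio.
have le2 : n%:R + s - 2 + s * \sum_(C in cmps) #|C|%:R / (rho - s + 2 - 2 * #|C|%:R) <=
    n%:R + s - 2 + s * ((#|S| - k + 1)%:R * p%:R / (rho - s + 2 - 2 * p%:R)
    + M%:R / (rho - s + 2 - 2 * M%:R)) by rewrite lerD2l ler_wpM2l ?ler0n // le1.
have E2 : n%:R + s - 2 + s * ((#|S| - k + 1)%:R * p%:R / (rho - s + 2 - 2 * p%:R)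
    + M%:R / (rho - s + 2 - 2 * M%:R)) = rho.
  by apply/le_anti; rewrite Fle.1 -[X in X <= _]E le2.
have Sd : #|S| = d by apply/eqP; rewrite -Fle.2 E2.
move: E; rewrite -[RHS]E2 => /addrI /(mulfI _) E.
have : \sum_(C in cmps) #|C|%:R / (rho - s + 2 - 2 * #|C|%:R) ==
  (#|S| - k + 1)%:R * p%:R / (rho - s + 2 - 2 * p%:R) + M%:R / (rho - s + 2 - 2 * M%:R).
  by rewrite E // pnatr_eq0 -lt0n.
rewrite le1.2 => /andP[/eqP c1 /forall_inP c2]; split=> //.
  by rewrite c1 Sd.
move=> C /c2 /orP[]/eqP ->; last by right.
by left; rewrite Sd subnn.
Qed.

End BarrierBound.

(** * The equality case and recognition of the extremal graph *)

Lemma unique_large_block (T : finType) (P : {set {set T}}) (M : nat) :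
  (1 < M)%N -> (0 < #|P|)%N -> (\sum_(C in P) #|C| = #|P|.-1 + M)%N ->
  (forall C, C \in P -> #|C| = 1%N \/ #|C| = M) ->
  exists2 C0, C0 \in P & #|C0| = M /\ forall C, C \in P -> C != C0 -> #|C| = 1%N.
Proof.
move=> M1 P0 sP sz.
have sz1 C : C \in P -> (1 <= #|C|)%N by case/sz=> ->; lia.
have ge1 (Q : {set {set T}}) : Q \subset P -> (#|Q| <= \sum_(C in Q) #|C|)%N.
  by move=> sQ; rewrite -sum1_card; apply: leq_sum => C /(subsetP sQ)/sz1.
have [/existsP[C0 /andP[C0P /eqP sC0]]|/existsPn none] :=
    boolP [exists C, (C \in P) && (#|C| == M)].
  exists C0 => //; split=> // C CP CC0; have [//|sC] := sz C CP.
  have CD : C \in P :\ C0 by rewrite !inE CC0.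
  (* A second block of size [M > 1] would make the total too large. *)
  have := ge1 (P :\ C0 :\ C); move: sP; rewrite (big_setD1 C0) //= (big_setD1 C) //=.
  rewrite (cardsD1 C0 P) C0P (cardsD1 C (P :\ C0)) CD !add1n /= sC0 sC => E.
  have sub : P :\ C0 :\ C \subset P.
    by apply: subset_trans (subD1set _ _) (subD1set _ _).
  by move/(_ sub) => le1; move: E le1; move: #|_| (\sum_(_ in _) _)%N => a b; lia.
have : (\sum_(C in P) #|C| = #|P|)%N.
  rewrite -sum1_card; apply: eq_bigr => C CP; have [//|sC] := sz C CP.
  by have := none C; rewrite CP sC eqxx.
by rewrite sP; lia.
Qed.

(** As the components other than [C0] are singletons, the class [c] determines adjacency, and equal
    class sizes give the bijection. *)
Lemma isomorphic_extremal (G : sgraph) (S C0 : {set G}) (n d k : nat) :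
  #|G| = n -> #|S| = d -> (k <= d)%N -> (2 * d < n)%N ->
  (forall x y, closure_adj S x y -> adj x y) ->
  C0 \in components (@adj G) (~: S) -> #|C0| = (n - 2 * d + k - 1)%N ->
  (forall C, C \in components (@adj G) (~: S) -> C != C0 -> #|C| = 1%N) ->
  isomorphic G (extremal n d k).
Proof.
move=> nG sS kd dn full C0P sC0 sC.
pose c (x : G) : option bool := if x \in S then None else Some (x \in C0).
have C0S x : x \in C0 -> x \notin S.
  by case/componentsP: C0P => z _ -> /setIdP[]; rewrite inE.
have adjE x y : adj x y = (x != y) && class_adj (c x) (c y).
  have -> : adj x y = closure_adj S x y.
    by apply/idP/idP; [exact: adj_closure|exact: full].
  rewrite /closure_adj; have [//|xy] := eqVneq x y; rewrite /= /c.
  have [//|xS] := boolP (x \in S); have [//|yS] := boolP (y \in S).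
  have xB : x \in ~: S by rewrite inE.
  have yB : y \in ~: S by rewrite inE.
  rewrite /=; apply/idP/andP => [cxy|[xC yC]]; last first.
    by move: yC; rewrite (component_eq (@adj_sym G) C0P xC) => /setIdP[].
  have yx : y \in component (@adj G) (~: S) x by rewrite inE yB.
  have xx : x \in component (@adj G) (~: S) x by rewrite mem_component.
  have xP := component_components (@adj G) xB.
  have [<- //|ne] := eqVneq (component (@adj G) (~: S) x) C0.
  have := sC _ xP ne; move/eqP/cards1P => [z zE].
  by move: yx xx xy; rewrite zE !inE => /eqP-> /eqP->; rewrite eqxx.
have [f fbij fc] : exists2 f : G -> extremal n d k, bijective f &
    forall x, extremal_class (f x) = c x.
  apply: class_bijection => i; rewrite card_extremal_class.
  have cN : [set x | c x == None] = S.
    by apply/setP => x; rewrite inE /c; case: (x \in S).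
  have cT : [set x | c x == Some true] = C0.
    apply/setP => x; rewrite inE /c; have [xS|xS] := boolP (x \in S).
      by apply/esym/negP => /C0S; rewrite xS.
    by case: (x \in C0).
  case: i => [[]|]; rewrite ?cN ?cT //.
  have -> : [set x | c x == Some false] = ~: (S :|: C0).
    by apply/setP => x; rewrite !inE /c; case: (x \in S) => //; case: (x \in C0).
  have := cardsC (S :|: C0); rewrite cardsU.
  have -> : S :&: C0 = set0.
    by apply/setP => x; rewrite !inE; apply/negP => /andP[xS /C0S]; rewrite xS.
  rewrite cards0 sS sC0 nG; lia.
exists f => // x y; rewrite extremal_adjE !fc adjE.
by rewrite (inj_eq (bij_inj fbij)).
Qed.

(** By [perron_comparison], [v] vanishes wherever [w] is strict, in particular at the ends of
    closure edges missing from [G], and its zeros spread along edges. For nonempty [S], the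
    contradiction is that [v] vanishes on [S], hence everywhere. *)
Lemma isomorphic_extremal_of_barrier (R : realType) (G : sgraph) (S : {set G}) (n d k : nat) :
  #|G| = n -> (0 < d)%N -> (k < d)%N -> (9 * d - 2 * k + 12 <= n)%N ->
  (forall x : G, (d <= deg x)%N) ->
  (k <= #|S|)%N -> (#|S| - k + 2 <= #|components (@adj G) (~: S)|)%N ->
  q R (extremal n d k) <= q R G ->
  isomorphic G (extremal n d k).
Proof.
move=> nG d0 k_lt n_large dG kS cS qle; apply: contrapT => niso.
have G0 : (0 < #|G|)%N by lia.
set rho := q R (extremal n d k) in qle.
pose w := barrier_weight S rho.
have [M0 _] := barrier_bound R nG d0 k_lt n_large dG kS cS.
have den x : x \notin S ->
    0 < rho - #|S|%:R + 2 - 2 * #|component (@adj G) (~: S) x|%:R.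
  move=> xS; apply: lt_le_trans M0 _; rewrite lerD2l lerN2 ler_pM2l // ler_nat.
  apply: components_size_le => //; last by apply: component_components; rewrite inE.
have w0 x : 0 < w x.
  rewrite /w /barrier_weight; case: ifP => [xS|/negbT xS]; rewrite invr_gt0 ?den //.
  by rewrite ltr0n; apply/card_gt0P; exists x.
have cl_out x : x \notin S -> slap (closure_adj S) w x = rho * w x - 1 + #|S|%:R / #|S|%:R.
  by move=> xS; rewrite slap_closure_out ?den.
have S_pos x : x \in S -> 0 < #|S|%:R :> R.
  by move=> xS; rewrite ltr0n; apply/card_gt0P; exists x.
have wS x : x \in S -> rho * w x * #|S|%:R = rho.
  by move=> xS; rewrite /w /barrier_weight xS mulfVK // gt_eqF // (S_pos x xS).
have val_le := barrier_value_le R nG d0 k_lt n_large dG kS cS.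
have cl_le x : slap (closure_adj S) w x <= rho * w x.
  have [xS|xS] := boolP (x \in S).
    by rewrite -(ler_pM2r (S_pos x xS)) wS // slap_closure_in // nG.
  rewrite cl_out //; have [->|s0] := eqVneq (#|S|%:R : R) 0.
    by rewrite mul0r addr0 lerBlDr lerDl.
  by rewrite mulfV // addrNK.
have sub x : slap (@adj G) w x <= slap (closure_adj S) w x
    ?= iff [forall y, closure_adj S x y ==> adj x y].
  by apply: slap_sub => // y; apply: adj_closure.
have wQ x : slap (@adj G) w x <= rho * w x by apply: le_trans (sub x).1 _.
have [v [[x0 vx0] v_strict v_adj]] := perron_comparison G0 w0 wQ qle.
have v_miss x y : closure_adj S x y -> ~~ adj x y -> v x = 0.
  move=> cxy nxy; apply: v_strict; apply: lt_le_trans (cl_le x).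
  rewrite (lt_leif (sub x)); apply/forallPn; exists y.
  by rewrite cxy (negPf nxy).
(* For empty [S], [slap_closure_out] makes [w] strict at every vertex. *)
have [S0|/set0Pn[z zS]] := eqVneq S set0.
  case/eqP: vx0; apply: v_strict; apply: le_lt_trans (sub x0).1 _.
  rewrite cl_out ?S0 ?inE // cards0 mul0r addr0 ltrBlDr ltrDl //.
(* A vertex outside [S] is either adjacent to [z], so the zero spreads to it, or misses a closure
   edge. *)
have v_S : ~ forall y, y \in S -> v y = 0.
  move=> vS; case/eqP: vx0.
  have [/vS//|x0S] := boolP (x0 \in S).
  have [a|na] := boolP (adj z x0); first exact: v_adj a (vS z zS).
  apply: (@v_miss x0 z); last by rewrite adj_sym.
  by rewrite /closure_adj zS orbT andbT; apply: contraNneq x0S => ->.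
move: val_le; rewrite le_eqVlt => /orP[/eqP val_eq|val_lt]; last first.
  apply: v_S => y yS; apply: v_strict; apply: le_lt_trans (sub y).1 _.
  by rewrite -(ltr_pM2r (S_pos y yS)) wS // slap_closure_in // nG.
have S0 : (0 < #|S|)%N by apply/card_gt0P; exists z.
have [Sd cP sizes] := barrier_value_eq nG d0 k_lt n_large dG kS cS S0 val_eq.
have ME : (n - #|S| - (#|S| - k + 1) * (d - #|S|).+1 = n - 2 * d + k - 1)%N.
  by rewrite Sd subnn muln1; lia.
have [C0 C0P [sC0 sC]] : exists2 C0, C0 \in components (@adj G) (~: S) &
    #|C0| = (n - 2 * d + k - 1)%N /\
    forall C, C \in components (@adj G) (~: S) -> C != C0 -> #|C| = 1%N.
  apply: unique_large_block; rewrite -?ME //.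
  - by rewrite ME; lia.
  - by rewrite cP; lia.
  - rewrite sum_card_components ME nG cP; lia.
have [a [b [cab nab]]] : exists a b, closure_adj S a b /\ ~~ adj a b.
  apply: contrapT => full; apply: niso.
  apply: (isomorphic_extremal nG Sd (ltnW k_lt) _ _ C0P sC0 sC); first lia.
  move=> x y cxy; apply: contrapT => nxy; apply: full; exists x, y.
  by split=> //; apply/negP.
have [C1 C1P C10] : exists2 C, C \in components (@adj G) (~: S) & C != C0.
  have : (0 < #|components (@adj G) (~: S) :\ C0|)%N.
    by have := cardsD1 C0 (components (@adj G) (~: S)); rewrite C0P cP; lia.
  by case/card_gt0P=> C /setD1P[]; exists C.
(* The vertex of a singleton component has neighbours only in [S], and its degree is at least
   [d = #|S|]. *)
have [x1 x1S adj1] : exists2 x1, x1 \notin S & forall y, y \in S -> adj x1 y.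
  have /eqP/cards1P[x1 C1E] := sC C1 C1P C10.
  have x1C : x1 \in C1 by rewrite C1E inE.
  have x1S : x1 \notin S by case/componentsP: C1P x1C => u _ -> /setIdP[]; rewrite inE.
  exists x1 => //.
  have /eqP N1 : [set y | adj x1 y] == S.
    rewrite eqEcard Sd; apply/andP; split; last first.
      by apply: leq_trans (dG x1) _; rewrite /deg cardsE.
    apply/subsetP => y; rewrite inE => /(adj_closure S)/andP[xy].
    rewrite (negPf x1S) /=; have [//|yS /= cxy] := boolP (y \in S).
    have : y \in C1 by rewrite (component_eq (@adj_sym G) C1P x1C) !inE yS.
    by rewrite C1E inE eq_sym (negPf xy).
  by move=> y; rewrite -{1}N1 inE.
(* If both [a] and [b] lie outside [S], then [z] gets its zero from [a] along an edge, or from the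
   missing closure edge between them. *)
have [z' z'S vz'] : exists2 y, y \in S & v y = 0.
  have va := v_miss _ _ cab nab.
  have [aS|aS] := boolP (a \in S); first by exists a.
  have az x : x \in S -> closure_adj S x a.
    by move=> xS; rewrite /closure_adj xS andbT; apply: contraNneq aS => <-.
  have [bS|bS] := boolP (b \in S).
    by exists b => //; apply: (v_miss b a); rewrite ?az // adj_sym.
  exists z => //; have [e|ne] := boolP (adj a z); first exact: v_adj e va.
  by apply: (v_miss z a); rewrite ?az // adj_sym.
(* Connectivity of [G] is not assumed; the zero reaches all of [S] through [x1]. *)
have vx1 : v x1 = 0 by apply: (v_adj z') => //; rewrite adj_sym adj1.
by apply: v_S => y yS; apply: (v_adj x1) => //; apply: adj1.
Qed.

Theorem theorem1p2 (R : realType) (n delta k : nat)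
  (n_gt0 : (0 < n)%N) (delta_gt0 : (0 < delta)%N)
  (delta_le : (delta <= n - 1)%N)
  (k_lt : (k < delta)%N) (k_n_parity : k = n %[mod 2])
  (n_large : (9 * delta - 2 * k + 12 <= n)%N) :
  (forall G : sgraph, #|G| = n -> has_min_degree G delta ->
     q R (extremal n delta k) <= q R G ->
     ~ isomorphic G (extremal n delta k) -> factor_critical k G)
  /\ is_largest_root (g_poly n%:R delta%:R k%:R) (q R (extremal n delta k)).
Proof.
split; last exact: q_extremal_largest_root.
move=> G nG [_ dG] qle niso; apply: contrapT => nfc; apply: niso.
have kG : (k <= #|G|)%N by rewrite nG; lia.
have ev : ~~ odd (#|G| - k) by rewrite nG; lia.
have [S [kS cS]] := not_factor_critical_barrier kG ev nfc.
exact: (@isomorphic_extremal_of_barrier R G S).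
Qed.
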